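(* Assume $\gcd(p,q)=1$, fix $a\in\mathcal A_{\mathrm{cyc}}$, and let $\mathcal L_{(a)}(\boldsymbol0)=\mathcal S^q+c^{(a)}\mathcal S^{-p}$. In every fixed finite set of times, let $\mathcal L_{(a)}(\boldsymbol t)=\mathcal S^q+c^{(a)}(\boldsymbol t)\mathcal S^{-p}$ be the unique coefficientwise formal solution of the Lax equations $\partial_{t_\ell}\mathcal L=[(\mathcal L^{M\ell})_+,\mathcal L]$ with initial operator $\mathcal L_{(a)}(\boldsymbol0)$, whose semi-infinite matrix is $\mathscr H_{(a)}$. This formal solution is reconstructed coefficientwise from the deformed moment matrix $\widehat{\mathscr M}_{(a)}(\boldsymbol t)$: its nontrivial coefficients are \[ c_h^{(a)}(\boldsymbol t)=\frac{\tau_{h-p}^{(a)}(\boldsymbol t)\,\tau_{h+1}^{(a)}(\boldsymbol t)}{\tau_{h-p+1}^{(a)}(\boldsymbol t)\,\tau_h^{(a)}(\boldsymbol t)},\qquad h\ge p . \] For the analytic interpretation, fix $L<\infty$, set $t_\ell=0$ for $\ell>L$, and let $D\subset\mathbb C^L$ be a connected open neighbourhood of $\boldsymbol0$ on which all the deformed pairings $\langle\widehat\Psi_{(a),j,i},\lambda^nE_{\boldsymbol t}(\lambda)\rangle$ exist and depend holomorphically on $\boldsymbol t$. For each $h\ge p$, let $D_h$ be the connected component containing $\boldsymbol0$ of $\{\boldsymbol t\in D:\tau_N^{(a)}(\boldsymbol t)\ne0,\ 1\le N\le h+1\}$. Then the finite Gauss--Borel construction (factorization of $\widehat{\mathscr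 M}_{(a)}(\boldsymbol t)$ as unit lower triangular inverse times upper triangular inverse) through row $h$ exists holomorphically on $D_h$, and the displayed formula for $c_h^{(a)}$ holds there. In particular, every fixed coefficient $c_h^{(a)}$ is analytic in a neighbourhood of $\boldsymbol0$, which may depend on $h$. If all leading principal minors $\tau_N^{(a)}$, $N\ge1$, remain nonzero throughout $D$, then the full recurrence is coefficientwise holomorphic on $D$.
   Context: Let $p,q\ge1$ be coprime, $M=p+q$. Matrices are semi-infinite, indexed by $\mathbb N_0$. A lower bidiagonal $L$ is normalized if $L_{n,n}=1$, an upper bidiagonal $U$ is normalized if $U_{n,n+1}=1$; positive means that the remaining entries are all $>0$. Let $T=L_1\cdots L_pU_q\cdots U_1$ with all factors normalized positive; $F_k=L_k$ ($1\le k\le p$), $F_{p+b}=U_{q-b+1}$ ($1\le b\le q$). $\mathcal A_{\mathrm{cyc}}=\{a_-,\dots,a_+\}$, $a_-=p-\lceil p/q\rceil+1$, $a_+=p+1+\min\{q-1,\lceil q/p\rceil\}$. Let $r_k$ be the remainder of $kq$ mod $M$, and $\sigma_{\mathrm{min}}$ the word of length $M$ whose $(k+1)$-st letter is $L$ if $r_k<p$ and $U$ otherwise. For $a\in\mathcal A_{\mathrm{cyc}}$, finitely many replacements of a neighbouring pair $U,L$ (upper before lower) by the unique normalized positive pair $\widetilde L,\widetilde U$ with $UL=\widetilde L\widetilde U$ transform $(F_a,\dots,F_M,F_1,\dots,F_{a-1})$ into a list $(\widetilde F^{(a)}_1,\dots,\widetilde F^{(a)}_M)$ of normalized positive bidiagonal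 factors with type word $\sigma_{\mathrm{min}}$ (independent of choices). For a height $h=Mn+\rho$, $0\le\rho<M$, let $k(\rho)\in\{0,\dots,M-1\}$ satisfy $k(\rho)q\equiv\rho\pmod M$ and $j=k(\rho)+1$. Put $c_h^{(a)}=(\widetilde F^{(a)}_j)_{n,n-1}$ if $\widetilde F^{(a)}_j$ is lower and $n\ge1$, $c_h^{(a)}=(\widetilde F^{(a)}_j)_{n,n}$ if it is upper; this defines $c_h^{(a)}>0$ for all $h\ge p$; put $c_h^{(a)}=0$ for $h<p$. The matrix $\mathscr H_{(a)}$ has entries $(\mathscr H_{(a)})_{h,h+q}=1$ ($h\ge0$), $(\mathscr H_{(a)})_{h,h-p}=c_h^{(a)}$ ($h\ge p$), and zeros elsewhere. $\mathcal S$ is the forward shift $(\mathcal Sf)_h=f_{h+1}$; difference operators multiply by $\mathcal S^jc=c_{\,\cdot+j}\mathcal S^j$, and $X_+$ denotes the part with nonnegative powers of $\mathcal S$. Star moment functionals: for $0\le j<q$, $0\le i<p$, $\langle\widehat\Psi_{(a),j,i},\lambda^n\rangle=((\mathscr H_{(a)})^n)_{j,i}$. With $E_{\boldsymbol t}(\lambda)=\exp(\sum_{\ell\ge1}t_\ell\lambda^{M\ell})$, the deformed step-line moment matrix is $(\widehat{\mathscr M}_{(a)}(\boldsymbol t))_{qu+j,pv+i}=\langle\widehat\Psi_{(a),j,i},\lambda^{u+v}E_{\boldsymbol t}(\lambda)\rangle$, understood as formal power series in finitely many active times (and, in the analytic interpretation, as holomorphic functions on $D$). $\tau_0^{(a)}=1$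 and, for $N\ge1$, $\tau_N^{(a)}(\boldsymbol t)$ is the determinant of the leading $N\times N$ block of $\widehat{\mathscr M}_{(a)}(\boldsymbol t)$. *)

(* Defs.v *)
From HB Require Import structures.
From Stdlib Require Export Relations.Relation_Operators.
From mathcomp Require Export all_boot all_order all_algebra finmap.
From mathcomp Require Export complex.
From mathcomp Require Export all_classical all_reals all_analysis.
From mathcomp Require summability.

Set Implicit Arguments.
Unset Strict Implicit.
Unset Printing Implicit Defensive.

Export Order.TTheory GRing.Theory Num.Theory numFieldNormedType.Exports.

Local Open Scope classical_set_scope.
Local Open Scope ring_scope.
Local Open Scope complex_scope.

(** * Formal power series in finitely many variables *)

Definition mindex (r : nat) := {ffun 'I_r -> nat}.

(* A series in [t_0, ..., t_(r-1)] is the family of its coefficients; [f m] is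
   the coefficient of the monomial [prod_l t_l ^ (m l)]. *)
Definition fps (r : nat) (K : fieldType) : Type := mindex r -> K.

Section FpsRing.
Variables (r : nat) (K : fieldType).
Implicit Types (f g h : fps r K) (m k : mindex r).

HB.instance Definition _ := GRing.Zmodule.copy (fps r K) (mindex r -> K).

Definition fps_one : fps r K := fun m => (m == 0)%:R.

Definition fps_mul f g : fps r K := fun m =>
  \sum_(k \in [set k : mindex r * mindex r | k.1 + k.2 = m]) f k.1 * g k.2.

Let box (N : nat) := {ffun 'I_r -> 'I_N.+1}.
Let bval N (k : box N) : mindex r := [ffun i => k i : nat].

Let bval_inj N : injective (@bval N).
Proof.
move=> k l /ffunP e; apply/ffunP => i; apply: val_inj.
by have := e i; rewrite !ffunE.
Qed.

Let bvalP N m : (forall i, m i <= N)%N -> exists k : box N, bval k = m.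
Proof.
move=> mN; exists [ffun i => inord (m i)].
by apply/ffunP => i; rewrite !ffunE inordK ?ltnS.
Qed.

Let fps_mulE N f g m : (forall i, m i <= N)%N ->
  fps_mul f g m = \sum_(k : box N) \sum_(l : box N)
     (bval k + bval l == m)%:R * (f (bval k) * g (bval l)).
Proof.
move=> mN; rewrite /fps_mul pair_big /=.
under [RHS]eq_bigr => u _ do rewrite mulr_natl mulrb.
rewrite -big_mkcond /=.
pose s : seq (mindex r * mindex r) := [seq (bval u.1, bval u.2) | u <-
  [seq u <- index_enum (box N * box N)%type | bval u.1 + bval u.2 == m]].
have us : uniq s.
  rewrite map_inj_uniq; first by rewrite filter_uniq // index_enum_uniq.
  by move=> [a b] [c d] [] /bval_inj -> /bval_inj ->.
have -> : [set k : mindex r * mindex r | k.1 + k.2 = m] = [set` s].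
  apply/seteqP; split => -[a b] /=.
    move=> abm.
    have [|k ka] := @bvalP N a.
      move=> i; apply: leq_trans (mN i); rewrite -abm ffunE; exact: leq_addr.
    have [|l lb] := @bvalP N b.
      move=> i; apply: leq_trans (mN i); rewrite -abm ffunE; exact: leq_addl.
    apply/mapP; exists (k, l); last by rewrite /= ka lb.
    by rewrite mem_filter /= ka lb abm eqxx mem_index_enum.
  by move=> /mapP[[k l]]; rewrite mem_filter /= => /andP[/eqP <- _] [-> ->].
by rewrite -fsbig_seq // big_map big_filter.
Qed.

Let mbound m : exists N, forall i, (m i <= N)%N.
Proof. by exists (\max_i m i)%N => i; exact: leq_bigmax. Qed.

Let fps_mulC : commutative fps_mul.
Proof.
move=> f g; apply/funext => m; have [N mN] := mbound m.
rewrite !(fps_mulE _ _ mN) exchange_big /=; apply: eq_bigr => k _.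
by apply: eq_bigr => l _; rewrite addrC (mulrC (f _)).
Qed.

Let fps_mulDl : left_distributive fps_mul +%R.
Proof.
move=> f g h; apply/funext => m; have [N mN] := mbound m.
rewrite -[RHS]/(fps_mul f h m + fps_mul g h m) !(fps_mulE _ _ mN) -big_split.
apply: eq_bigr => k _; rewrite -big_split; apply: eq_bigr => l _ /=.
by rewrite -mulrDr -mulrDl.
Qed.

Let fps_mul1 : left_id fps_one fps_mul.
Proof.
move=> f; apply/funext => m; have [N mN] := mbound m.
rewrite (fps_mulE _ _ mN).
have [k0 k00] : exists k : box N, bval k = 0.
  by apply: bvalP => i; rewrite ffunE.
have [km kmm] := bvalP mN.
rewrite (bigD1 k0) //= [X in _ + X]big1 ?addr0 => [|k kk0].
  rewrite (bigD1 km) //= [X in _ + X]big1 ?addr0 => [|l lm].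
    by rewrite k00 kmm add0r eqxx /fps_one eqxx !mul1r.
  by rewrite k00 add0r -kmm (inj_eq (@bval_inj N)) (negbTE lm) mul0r.
rewrite big1 // => l _; rewrite /fps_one -k00 (inj_eq (@bval_inj N)).
by rewrite (negbTE kk0) mul0r mulr0.
Qed.

Let fps_mulA3 N f g h m : (forall i, m i <= N)%N ->
  fps_mul (fps_mul f g) h m =
  \sum_(c : box N) \sum_(a : box N) \sum_(b : box N)
    (bval a + bval b + bval c == m)%:R * (f (bval a) * g (bval b) * h (bval c)).
Proof.
move=> mN; rewrite (fps_mulE _ _ mN) exchange_big; apply: eq_bigr => c _ /=.
transitivity (\sum_(d : box N) \sum_(a : box N) \sum_(b : box N)
   (bval d + bval c == m)%:R * ((bval a + bval b == bval d)%:R *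
     (f (bval a) * g (bval b) * h (bval c)))).
  apply: eq_bigr => d _; rewrite (@fps_mulE N) => [|i]; last first.
    by rewrite ffunE -ltnS.
  rewrite mulr_suml mulr_sumr; apply: eq_bigr => a _.
  rewrite mulr_suml mulr_sumr; apply: eq_bigr => b _.
  by rewrite !mulrA.
rewrite exchange_big; apply: eq_bigr => a _ /=.
rewrite exchange_big; apply: eq_bigr => b _ /=.
have [abc|abc] := eqVneq (bval a + bval b + bval c) m.
  have [|d dE] := @bvalP N (bval a + bval b).
    move=> i; apply: leq_trans (mN i); rewrite -abc [leqRHS]ffunE.
    exact: leq_addr.
  rewrite (bigD1 d) //= [X in _ + X]big1 ?addr0 => [|e ed].
    by rewrite dE abc !eqxx !mul1r.
  by rewrite -dE (inj_eq (@bval_inj N)) [d == e]eq_sym (negbTE ed) mul0r mulr0.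
rewrite mul0r big1 // => d _; have [<-|_] := eqVneq (bval a + bval b) (bval d).
  by rewrite (negbTE abc) mul0r.
by rewrite mul0r mulr0.
Qed.

Let fps_mulA : associative fps_mul.
Proof.
move=> f g h; apply/funext => m; have [N mN] := mbound m.
rewrite (fps_mulC f) !(fps_mulA3 _ _ _ mN) [RHS]exchange_big /=.
apply: eq_bigr => a _; rewrite exchange_big; apply: eq_bigr => c _ /=.
apply: eq_bigr => b _; rewrite -(addrA (bval a)) (addrC (bval a)).
by rewrite -(mulrA (f _)) (mulrC (f _)).
Qed.

Let fps_one_neq0 : fps_one != 0.
Proof.
apply/eqP => /(congr1 (fun f : fps r K => f 0)); rewrite /fps_one eqxx.
by move/eqP; rewrite oner_eq0.
Qed.

HB.instance Definition _ := GRing.Zmodule_isComNzRing.Build (fps r K)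
  fps_mulA fps_mulC fps_mul1 fps_mulDl fps_one_neq0.

Definition fps_unit : pred (fps r K) := fun f => `[< exists g, g * f = 1 >].

Definition fps_inv f : fps r K :=
  if pselect (exists g, g * f = 1) is left ex then projT1 (cid ex) else f.

Let fps_mulVr : {in fps_unit, left_inverse 1 fps_inv *%R}.
Proof.
move=> f /asboolP ex; rewrite /fps_inv; case: pselect => // ex'.
by case: (cid ex').
Qed.

Let fps_unitP f g : g * f = 1 -> fps_unit f.
Proof. by move=> gf; apply/asboolP; exists g. Qed.

Let fps_invr_out : {in [predC fps_unit], fps_inv =1 id}.
Proof.
by move=> f /asboolP nf; rewrite /fps_inv; case: pselect.
Qed.

HB.instance Definition _ := GRing.ComNzRing_hasMulInverse.Build (fps r K)
  fps_mulVr fps_unitP fps_invr_out.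

(* Formal partial derivative with respect to [t_l]. *)
Definition fps_deriv (l : 'I_r) f : fps r K :=
  fun m => f (m + [ffun i => (i == l) : nat]) *+ (m l).+1.

End FpsRing.

(** * Semi-infinite matrices and positive bidiagonal factors *)

Definition smx (K : Type) := nat -> nat -> K.

(* The sum has finite support as soon as [A] is row-finite, in particular for
   all the banded matrices below. *)
Definition smx_mul (K : pzRingType) (A B : smx K) : smx K :=
  fun i k => \sum_(j \in [set: nat]) A i j * B j k.

Definition smx_exp (K : pzRingType) (A : smx K) (n : nat) : smx K :=
  iter n (smx_mul A) (fun i k => (i == k)%:R).

Definition leading (K : Type) (N : nat) (A : smx K) : 'M[K]_N :=
  \matrix_(i, j) A i j.

Definition tau (K : comPzRingType) (A : smx K) (N : nat) : K :=
  \det (leading N A).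

Variant letter := Lower | Upper.

Definition normalized_positive (R : realType) (x : letter) (A : smx R) : Prop :=
  match x with
  | Lower => [/\ forall n, A n n = 1, forall n, 0 < A n.+1 n
               & forall n m, m != n -> n != m.+1 -> A n m = 0]
  | Upper => [/\ forall n, A n n.+1 = 1, forall n, 0 < A n n
               & forall n m, m != n -> m != n.+1 -> A n m = 0]
  end.

(* [F_1, ..., F_(p+q)], that is [L_1, ..., L_p, U_q, ..., U_1], where the
   families [Lf] and [Uf] are only used at the indices [1..p] and [1..q]. *)
Definition factors (R : realType) (p q : nat) (Lf Uf : nat -> smx R) :
    seq (letter * smx R) :=
  [seq (Lower, Lf k) | k <- iota 1 p] ++
  [seq (Upper, Uf (q - b).+1) | b <- iota 1 q].

Inductive swap_step (R : realType) : seq (letter * smx R) ->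
    seq (letter * smx R) -> Prop :=
  SwapStep s1 s2 U L L' U' :
    normalized_positive Lower L' -> normalized_positive Upper U' ->
    smx_mul U L = smx_mul L' U' ->
    swap_step (s1 ++ [:: (Upper, U), (Lower, L) & s2])
              (s1 ++ [:: (Lower, L'), (Upper, U') & s2]).

Definition swaps (R : realType) := clos_refl_trans _ (@swap_step R).

Definition ceil_div (m d : nat) : nat := ((m + d).-1 %/ d)%N.

Definition cyc_min (p q : nat) : nat := (p - ceil_div p q + 1)%N.
Definition cyc_max (p q : nat) : nat :=
  (p + 1 + minn (q - 1) (ceil_div q p))%N.

Definition sigma_min (p q : nat) : seq letter :=
  mkseq (fun k => if (k * q %% (p + q) < p)%N then Lower else Upper) (p + q).

(* The unique [k < p + q] with [k * q = rho] modulo [p + q]. *)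
Definition kidx (p q rho : nat) : nat :=
  index rho [seq (k * q %% (p + q))%N | k <- iota 0 (p + q)].

(* The nontrivial coefficients read off a factor list [F] with word
   [sigma_min p q]; the default of [nth] is never reached. *)
Definition cyc_coef (R : realType) (p q : nat) (F : seq (letter * smx R))
    (h : nat) : R :=
  let n := (h %/ (p + q))%N in
  if (h < p)%N then 0 else
  match nth (Lower, fun _ _ => 0) F (kidx p q (h %% (p + q))) with
  | (Lower, A) => A n n.-1
  | (Upper, A) => A n n
  end.

Definition hess (K : pzRingType) (p q : nat) (c : nat -> K) : smx K :=
  fun h k => if k == (h + q)%N then 1 else if h == (k + p)%N then c h else 0.

(** * Difference operators and the Lax equations *)

(* [X k h] is the coefficient at the site [h] of the power [k] of the forward
   shift, i.e. [X] is the operator [sum_k (X k) S^k]. *)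
Definition dop (K : Type) := int -> int -> K.

Section Dop.
Variable K : pzRingType.
Implicit Types X Y : dop K.

(* [(a S^i) (b S^j) = a b_(. + i) S^(i + j)]; the sum has finite support for
   operators with finitely many nonzero powers at each site. *)
Definition dop_mul X Y : dop K :=
  fun k h => \sum_(i \in [set: int]) X i h * Y (k - i) (h + i).

Definition dop_exp X (n : nat) : dop K :=
  iter n (dop_mul X) (fun k _ => (k == 0)%:R).

Definition dop_comm X Y : dop K := fun k h => dop_mul X Y k h - dop_mul Y X k h.

Definition dop_pos X : dop K := fun k h => if 0 <= k then X k h else 0.

(* [S^q + c S^(-p)], with [c] extended by zero to the negative sites. *)
Definition lax_op (p q : nat) (c : nat -> K) : dop K := fun k h =>
  if k == q%:Z then 1 else
  if k == - p%:Z then (if h is Posz n then c n else 0) else 0.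

(* Its semi-infinite matrix has entry [(h, k)] equal to the coefficient of
   [S^(k - h)] at the site [h]. *)
Lemma lax_op_matrix (p q : nat) (c : nat -> K) (h k : nat) :
  lax_op p q c (k%:Z - h%:Z) h%:Z = hess p q c h k.
Proof.
rewrite /lax_op /hess subr_eq -PoszD eqz_nat (addnC q).
by rewrite -(inj_eq oppr_inj) opprB opprK subr_eq -PoszD eqz_nat (addnC p).
Qed.

End Dop.

(* The active times are [t_(ell l)], [l : 'I_r]. *)
Definition lax_solution (K : fieldType) (p q r : nat) (ell : 'I_r -> nat)
    (c0 : nat -> K) (c : nat -> fps r K) : Prop :=
  (forall h, c h 0 = c0 h) /\
  forall (l : 'I_r) (k h : int),
    fps_deriv l (lax_op p q c k h) =
    dop_comm (dop_pos (dop_exp (lax_op p q c) ((p + q) * ell l)))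
             (lax_op p q c) k h.

(** * Deformed moments *)

Section Moments.
Variables (K : fieldType) (p q : nat).

Definition star_functional (H : smx K) (j i : nat) (f : {poly K}) : K :=
  \sum_(n < size f) f`_n * smx_exp H n j i.

(* Coefficient, a polynomial in lambda, of the monomial with exponents [m] in
   the expansion of [exp (sum_l t_(ell l) lambda^((p + q) * ell l))]. *)
Definition exp_coef (r : nat) (ell : 'I_r -> nat) (m : mindex r) : {poly K} :=
  (\prod_l (m l)`!%:R)^-1 *: 'X^((p + q) * \sum_l ell l * m l).

Definition formal_pairing (r : nat) (ell : 'I_r -> nat) (H : smx K)
    (n j i : nat) : fps r K :=
  fun m => star_functional H j i ('X^n * exp_coef ell m).

End Moments.

(* Entry [(q u + j, p v + i)] is [w (u + v) j i], for [j < q] and [i < p]. *)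
Definition step_line (T : Type) (p q : nat) (w : nat -> nat -> nat -> T) :
    smx T :=
  fun r s => w (r %/ q + s %/ p)%N (r %% q)%N (s %% p)%N.

Definition formal_moment_matrix (K : fieldType) (p q r : nat)
    (ell : 'I_r -> nat) (H : smx K) : smx (fps r K) :=
  step_line p q (formal_pairing p q ell H).

Definition tau_ratio (K : comUnitRingType) (p : nat) (A : smx K) (h : nat) : K :=
  tau A (h - p) * tau A h.+1 / (tau A (h - p).+1 * tau A h).

(** * Gauss--Borel factorization *)

Section GaussBorel.
Variable K : fieldType.
Implicit Types A S U : smx K.

(* [A = S^-1 U^-1] on the leading [N x N] blocks, with [S] unit lower
   triangular and [U] invertible upper triangular. *)
Definition gauss_borel (N : nat) A S U : Prop :=
  [/\ forall i, (i < N)%N -> S i i = 1,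
      forall i j, (i < j < N)%N -> S i j = 0,
      forall i, (i < N)%N -> U i i != 0,
      forall i j, (j < i < N)%N -> U i j = 0
    & leading N A = invmx (leading N S) *m invmx (leading N U)].

(* The moment matrix satisfies [Lambda^q A = A (Lambda^T)^p], where [Lambda] is
   the shift matrix, so that [A = S^-1 U^-1] yields the recurrence matrix
   [S Lambda^q S^-1 = U^-1 (Lambda^T)^p U]. This is its entry [(h, h - p)];
   as [U] is upper triangular, it can be computed on the leading blocks. *)
Definition recurrence_coef (p : nat) U (h : nat) : K :=
  (invmx (leading h.+1 U)
     *m leading h.+1 (fun i j => (i == j + p)%N%:R)
     *m leading h.+1 U) ord_max (inord (h - p)).

End GaussBorel.

(** * Holomorphic functions of the times *)

(* The library's topology and norm on a [numFieldType] are keyed on the abstract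
   structure; this makes them available on the concrete type [R[i]]. *)
HB.instance Definition _ (R : rcfType) :=
  PseudoMetric.copy R[i] (R[i] : numFieldType).
HB.instance Definition _ (R : rcfType) :=
  NormedModule.copy R[i] (R[i] : numFieldType).

Section Holomorphic.
Variables (R : realType) (L : nat).
Implicit Types (D : set 'rV[R[i]]_L) (f : 'rV[R[i]]_L -> R[i]).

Definition holomorphic_on D f : Prop :=
  forall t, D t -> differentiable f t.

(* The family of the terms of the power series [F] at [t] is summable, i.e.
   converges along the finite sets of multi-indices, with sum [z]. *)
Definition fps_sums_to (F : fps L R[i]) (t : 'rV[R[i]]_L) (z : R[i]) : Prop :=
  summability.partial_sum (fun m : mindex L => F m * \prod_l t 0 l ^+ m l)
    @ summability.totally --> z.

(* [w n j i] is a holomorphic realization on [D] of the pairing of [lambda^n E_t]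
   with the star functional of indices [j], [i]: its expansion at the origin is
   the formal pairing. On a connected [D] this determines it. *)
Definition holomorphic_pairings (p q : nat) (H : smx R[i]) D
    (w : nat -> nat -> nat -> 'rV[R[i]]_L -> R[i]) : Prop :=
  forall n j i, (j < q)%N -> (i < p)%N ->
    holomorphic_on D (w n j i) /\
    \forall t \near (0 : 'rV[R[i]]_L),
      fps_sums_to (formal_pairing p q (fun l : 'I_L => l.+1) H n j i) t
                  (w n j i t).

Definition moment_matrix (p q : nat) (w : nat -> nat -> nat -> 'rV[R[i]]_L -> R[i])
    (t : 'rV[R[i]]_L) : smx R[i] :=
  step_line p q (fun n j i => w n j i t).

Definition tau_domain (A : 'rV[R[i]]_L -> smx R[i]) D (h : nat) :
    set 'rV[R[i]]_L :=
  connected_component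
    [set t | D t /\ forall N, (1 <= N <= h.+1)%N -> tau (A t) N != 0] 0.

End Holomorphic.

(* Main.v *)
From HB Require Import structures.
Require Import Defs.
From mathcomp Require Import zify ring.

(** The columns of a moment matrix [A] are linear functionals [phi_s] on
    polynomials, [phi_s (x^r) = A r s]. When the leading minors [tau_N] of [A]
    are invertible there is a unique monic polynomial [P_h] of degree [h] killed
    by [phi_s] for [s < h]; its coefficients are the row [h] of the unit lower
    triangular Gauss-Borel factor, and [phi_h (P_h) = tau_(h+1) / tau_h =: d_h].
    The whole argument is linear algebra with these polynomials.

    The step-line structure enters through two identities. Multiplication by
    [x^q] on rows is the shift by [p] on columns, [phi_s (x^q f) = phi_(s+p) (f)];
    and [A r s] vanishes unless [r] and [s] are congruent modulo [M = p + q],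
    because [H] moves indices by [q] or [-p], which agree modulo [M], and the
    times only multiply the moments by powers of [lambda^M]. Together they force
    the two-term recurrence [x^q P_h = P_(h+q) + c_h P_(h-p)]
    ([orthopoly_recurrence]) with
    [c_h = d_h / d_(h-p) = tau_(h-p) tau_(h+1) / (tau_(h-p+1) tau_h)].

    For the dynamics, the derivative of [A] in [t_l] is [A] with rows shifted by
    [q M l]. Expanding [x^(q M l) P_h] on the [P_k] has the entries of the power
    [L^(M l)] of the Lax operator as coefficients ([recurrence_exp]), and
    differentiating the orthogonality relations gives [d_h' = b_h d_h], where
    [b_h] is the diagonal coefficient of [L^(M l)] ([deriv_orthonorm]). Hence
    [c_h' = c_h (b_h - b_(h-p))]. This is the full Lax system: [L] commutes with
    its powers, and the powers of the shift occurring in [L^(M l)] are multiples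
    of [M], so the commutator with the nonnegative part has no other coefficient
    ([dop_comm_lax], [lax_solutionE]). At time zero the polynomials are obtained
    from the recurrence of [H] itself, so the minors are products of the positive
    coefficients and the ratio is the initial datum ([tau_ratio_initial]).
    A minor with nonzero constant term is an invertible series, so the ratio is
    a solution; coefficients of degree [d + 1] of a solution are determined by
    those of degree at most [d], so it is the only one ([lax_solution_unique]).

    On the analytic side the triangular factors are given by adjugates divided by
    minors, hence they are differentiable wherever these minors do not vanish
    ([gauss_borel_at]). To compare with the formal solution near the origin,
    power series with a finite weighted l^1-norm on some polydisc are shown to
    represent functions compatibly with ring operations and inverses
    ([representsM], [represents_inv]); the ratio of minors is then represented by
    the ratio of the formal minors ([tau_ratio_expansion]). *)

Set Implicit Arguments.
Unset Strict Implicit.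
Unset Printing Implicit Defensive.

Local Open Scope classical_set_scope.
Local Open Scope ring_scope.
Local Open Scope complex_scope.

Local Arguments dop_exp : simpl never.

(** * Gauss-Borel factors and orthogonal polynomials *)

Section Orthogonal.
Variables (K : comUnitRingType) (A : smx K).
Implicit Types (f g : {poly K}) (h s : nat).

(** The row [i] of the unit lower factor [S] is orthogonal to the first [i]
    columns of [A], so it is proportional to the last row of the inverse of the
    leading block of size [i + 1]; dually for the columns of the upper factor
    [U], with [A = S^-1 U^-1]. The adjugates make both explicit and analytic in
    the entries of [A]. *)
Definition gb_lower (i j : nat) : K :=
  if (j <= i)%N then (\adj (leading i.+1 A)) ord_max (inord j) / tau A i else 0.

Definition gb_upper (i j : nat) : K :=
  if (i <= j)%N then (\adj (leading j.+1 A)) (inord i) ord_max / tau A j.+1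
  else 0.

Lemma adj_last (n : nat) : (\adj (leading n.+1 A)) ord_max ord_max = tau A n.
Proof.
rewrite mxE /cofactor /= -signr_odd oddD addbb mul1r /tau; congr (\det _).
by apply/matrixP => i j; rewrite !mxE !lift_max.
Qed.

Lemma gb_lower_diag i : tau A i \is a GRing.unit -> gb_lower i i = 1.
Proof.
move=> ui; rewrite /gb_lower leqnn.
have -> : inord i = ord_max :> 'I_i.+1 by apply: val_inj; rewrite /= inordK.
by rewrite adj_last divrr.
Qed.

Lemma gb_lower_orth i s : tau A i \is a GRing.unit -> (s <= i)%N ->
  \sum_(j < i.+1) gb_lower i j * A j s = (tau A i.+1 / tau A i) *+ (s == i).
Proof.
move=> ui si; transitivity
    ((\adj (leading i.+1 A) *m leading i.+1 A) ord_max (inord s) / tau A i).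
  rewrite mxE mulr_suml; apply: eq_bigr => j _.
  by rewrite /gb_lower -ltnS ltn_ord inord_val !mxE inordK // mulrAC.
rewrite mul_adj_mx mxE -/(tau A i.+1).
have -> : (ord_max == inord s :> 'I_i.+1) = (s == i).
  by rewrite -val_eqE /= inordK // eq_sym.
by case: (s == i); rewrite ?mulr1n ?mulr0n ?mul0r.
Qed.

(** The linear functional whose moments are the column [s]. *)
Definition colform (s : nat) (f : {poly K}) : K :=
  \sum_(r < size f) f`_r * A r s.

Lemma colform_wide s f N : (size f <= N)%N ->
  colform s f = \sum_(r < N) f`_r * A r s.
Proof.
move=> fN; rewrite /colform (big_ord_widen _ (fun r => f`_r * A r s) fN).
rewrite big_mkcond /=; apply: eq_bigr => r _; case: ltnP => // fr.
by rewrite nth_default // mul0r.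
Qed.

Lemma colformD s f g : colform s (f + g) = colform s f + colform s g.
Proof.
have fN := leq_maxl (size f) (size g); have gN := leq_maxr (size f) (size g).
rewrite (colform_wide s fN) (colform_wide s gN).
rewrite (colform_wide s (size_polyD f g)) -big_split /=.
by apply: eq_bigr => r _; rewrite coefD mulrDl.
Qed.

Lemma colformZ s c f : colform s (c *: f) = c * colform s f.
Proof.
rewrite (colform_wide s (size_scale_leq c f)) /colform mulr_sumr.
by apply: eq_bigr => r _; rewrite coefZ mulrA.
Qed.

Lemma colformB s f g : colform s (f - g) = colform s f - colform s g.
Proof. by rewrite colformD -scaleN1r colformZ mulN1r. Qed.

Lemma colform_sum s N (F : nat -> {poly K}) :
  colform s (\sum_(k < N) F k) = \sum_(k < N) colform s (F k).
Proof.
elim: N => [|N IH]; last by rewrite !big_ord_recr /= colformD IH.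
by rewrite !big_ord0 /colform size_poly0 big_ord0.
Qed.

Lemma colform_XnM s n f :
  colform s ('X^n * f) = \sum_(r < size f) f`_r * A (n + r)%N s.
Proof.
have fN : (size ('X^n * f : {poly K})%R <= n + size f)%N.
  by apply: leq_trans (size_polyMleq _ _) _; rewrite size_polyXn addSn.
rewrite (colform_wide s fN) big_split_ord /= big1 ?add0r => [|r _]; last first.
  by rewrite coefXnM ltn_ord mul0r.
by apply: eq_bigr => r _; rewrite coefXnM ltnNge leq_addr /= addKn.
Qed.

(** The coefficients of [f] form a row vector in the left kernel of the
    leading block. *)
Lemma colform_eq0 h f : tau A h \is a GRing.unit -> (size f <= h)%N ->
  (forall s, (s < h)%N -> colform s f = 0) -> f = 0.
Proof.
move=> uh fh f0; pose v : 'rV[K]_h := \row_i f`_i.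
have vA : v *m leading h A = 0.
  apply/rowP => s; rewrite [RHS]mxE -(f0 s (ltn_ord s)) (colform_wide s fh) mxE.
  by apply: eq_bigr => r _; rewrite !mxE.
have v0 : v = 0.
  have uA : leading h A \in unitmx by rewrite unitmxE.
  by rewrite -[v](mulmxK uA) vA mul0mx.
apply/polyP => i; rewrite coef0; case: (ltnP i h) => ih.
  by move/rowP: v0 => /(_ (Ordinal ih)); rewrite !mxE.
by rewrite nth_default // (leq_trans fh).
Qed.

Definition orthopoly (h : nat) : {poly K} := \poly_(j < h.+1) gb_lower h j.

Definition orthonorm (h : nat) : K := tau A h.+1 / tau A h.

Lemma colform_orthopoly h s : tau A h \is a GRing.unit -> (s <= h)%N ->
  colform s (orthopoly h) = orthonorm h *+ (s == h).
Proof.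
move=> uh sh; rewrite (colform_wide s (size_poly _ _)) -gb_lower_orth //.
by apply: eq_bigr => j _; rewrite coef_poly ltn_ord.
Qed.

Lemma size_orthopolyB h f : tau A h \is a GRing.unit ->
  (size f <= h.+1)%N -> f`_h = 1 -> (size (f - orthopoly h)%R <= h)%N.
Proof.
move=> uh fh f1; apply/leq_sizeP => j; rewrite leq_eqVlt => /predU1P[<-|hj].
  by rewrite coefB f1 coef_poly ltnSn gb_lower_diag // subrr.
by rewrite coefB coef_poly ltnS leqNgt hj subr0 nth_default // (leq_trans fh).
Qed.

(** The polynomials are identified below through this characterization, never
    through their coefficients. *)
Lemma orthopolyP h f : tau A h \is a GRing.unit ->
  (size f <= h.+1)%N -> f`_h = 1 ->
  (forall s, (s < h)%N -> colform s f = 0) -> f = orthopoly h.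
Proof.
move=> uh fh f1 f0; apply/eqP; rewrite -subr_eq0; apply/eqP.
apply: (colform_eq0 uh); first exact: size_orthopolyB.
move=> s sh; rewrite colformB f0 // colform_orthopoly ?(ltnW sh) //.
by rewrite (ltn_eqF sh) subr0.
Qed.

End Orthogonal.

(** * Recurrence and deformation of the orthogonal polynomials *)

Section StepLine.
Variables (K : comUnitRingType) (p q : nat) (A : smx K).
Hypothesis utau : forall N, tau A N \is a GRing.unit.
Hypothesis shiftA : forall r s, A (q + r)%N s = A r (s + p)%N.
Hypothesis gradA : forall r s, r != s %[mod p + q] -> A r s = 0.

Local Notation P := (orthopoly A).

(** Discarding the other residue classes modulo [p + q] preserves the
    characterization of [P h]. *)
Lemma orthopoly_grading h j : j != h %[mod p + q] -> (P h)`_j = 0.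
Proof.
pose f := \poly_(i < h.+1) ((P h)`_i *+ (i == h %[mod p + q])).
suff <- : f = P h.
  move=> jh; rewrite coef_poly; case: ifP => // _.
  by rewrite (negbTE jh).
have fE s : s = h %[mod p + q] -> colform A s f = colform A s (P h).
  move=> sh; rewrite (colform_wide A s (size_poly _ _)).
  rewrite (colform_wide A s (size_poly _ _)); apply: eq_bigr => i _.
  rewrite coef_poly ltn_ord; case: eqVneq => // ih.
  by rewrite gradA ?mulr0 // sh.
apply: orthopolyP => //; first exact: size_poly.
  by rewrite coef_poly ltnSn eqxx coef_poly ltnSn gb_lower_diag.
move=> s sh; case: (eqVneq (s %% (p + q)) (h %% (p + q)))%N => [|ne].
  by move=> /fE ->; rewrite colform_orthopoly ?(ltnW sh) // (ltn_eqF sh).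
rewrite (colform_wide A s (size_poly _ _)) big1 // => i _.
rewrite coef_poly ltn_ord; case: eqVneq => [ih|]; last by rewrite mul0r.
by rewrite gradA ?mulr0 // ih eq_sym.
Qed.

Lemma colform_grading h s : s != h %[mod p + q] -> colform A s (P h) = 0.
Proof.
move=> sh; rewrite (colform_wide A s (size_poly _ _)) big1 // => i _.
have [ih|ih] := eqVneq (i %% (p + q))%N (h %% (p + q))%N.
  by rewrite gradA ?mulr0 // ih eq_sym.
by rewrite (orthopoly_grading ih) mul0r.
Qed.

Lemma colform_shift s (f : {poly K}) : colform A s ('X^q * f) = colform A (s + p) f.
Proof.
by rewrite colform_XnM /colform; apply: eq_bigr => r _; rewrite shiftA.
Qed.

(** The difference [x^q P_h - c_h P_(h-p)] is monic of degree [h + q]. On a column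
    [s < h + q] its value is [phi_(s+p) (P_h) - c_h phi_s (P_(h-p))]. Both terms
    vanish for [s < h - p], by orthogonality, and outside the residue class of
    [h - p]; the only index left below [h + q = (h - p) + (p + q)] is [h - p],
    and [c_h] makes the two terms cancel there. *)
Lemma orthopoly_recurrence h (pq : (0 < p + q)%N) :
  'X^q * P h = P (h + q) +
    (if (p <= h)%N then tau_ratio p A h *: P (h - p) else 0).
Proof.
set c := (if _ then _ else _).
have cform s : (s < h + q)%N -> colform A s c = colform A (s + p) (P h).
  move=> shq; have [sph|sph] := eqVneq ((s + p) %% (p + q))%N (h %% (p + q))%N;
    last first.
    rewrite (colform_grading sph) /c; case: (leqP p h) => ph.
      rewrite colformZ colform_grading ?mulr0 //; apply: contra_neq sph => e.
      by rewrite -modnDml e modnDml subnK.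
    by rewrite /colform size_poly0 big_ord0.
  have [sph'|sph'] := ltnP (s + p) h.
    rewrite colform_orthopoly ?(ltnW sph') // (ltn_eqF sph') /c.
    case: (leqP p h) => ph; last by rewrite /colform size_poly0 big_ord0.
    rewrite colformZ colform_orthopoly //; last by lia.
    by rewrite (_ : (s == h - p)%N = false) ?mulr0 //; lia.
  (* a positive multiple of the period would give s at least h + q *)
  have {sph sph'} hE : h = (s + p)%N.
    move/eqP: sph; rewrite eqn_mod_dvd // => /dvdnP[[|k]]; first by lia.
    by rewrite mulSn; lia.
  rewrite colform_orthopoly ?hE // eqxx /c hE leq_addl addnK.
  rewrite colformZ colform_orthopoly // eqxx !mulr1n /tau_ratio /orthonorm addnK.
  rewrite invrM // [tau A s * _]mulrC -!mulrA mulKr //.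
  by rewrite [tau A s * _]mulrCA divrr // mulr1.
apply: (canRL (subrK c)); apply: orthopolyP => //.
- apply: leq_trans (size_polyD _ _) _; rewrite size_polyN geq_max.
  apply/andP; split.
    apply: leq_trans (size_polyMleq _ _) _; rewrite size_polyXn addSn /=.
    by rewrite addnC -addSn leq_add2r size_poly.
  rewrite /c; case: (leqP p h) => ph; last by rewrite size_poly0.
  apply: leq_trans (size_scale_leq _ _) _.
  by apply: leq_trans (size_poly _ _) _; lia.
- rewrite coefB coefXnM ltnNge leq_addl /= addnK coef_poly ltnSn gb_lower_diag //.
  rewrite /c; case: (leqP p h) => ph; last by rewrite coef0 subr0.
  by rewrite coefZ coef_poly ltnS leqNgt (_ : h - p < h + q)%N ?mulr0 ?subr0 //; lia.
- by move=> s sh; rewrite colformB colform_shift cform // subrr.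
Qed.

End StepLine.

Section Derivation.
Variables (K : comUnitRingType) (A : smx K) (D : K -> K) (n : nat).
Hypothesis utau : forall N, tau A N \is a GRing.unit.
Hypothesis DD : forall x y, D (x + y) = D x + D y.
Hypothesis DM : forall x y, D (x * y) = D x * y + x * D y.
Hypothesis DA : forall r s, D (A r s) = A (n + r)%N s.

Let D0 : D 0 = 0.
Proof. by apply: (@addrI _ (D 0)); rewrite -DD !addr0. Qed.

Let D1 : D 1 = 0.
Proof.
apply: (@addrI _ (D 1)).
by rewrite -{1}[D 1]mulr1 -{2}[D 1]mul1r -DM mulr1 addr0.
Qed.

Lemma deriv_colform s (f : {poly K}) :
  D (colform A s f) = colform A s ('X^n * f) + colform A s (map_poly D f).
Proof.
rewrite colform_XnM (colform_wide A s (size_poly _ _)).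
rewrite /colform (big_morph D DD D0) -big_split; apply: eq_bigr => r _ /=.
by rewrite DM DA coef_map_id0 // addrC.
Qed.

(** Differentiating [phi_s (P_h) = 0] for [s < h] gives
    [phi_s (x^n P_h + P_h') = 0]. Since [P_h'] has degree below [h], it cancels the
    terms [k < h] of the expansion of [x^n P_h]. In the derivative of
    [d_h = phi_h (P_h)] only the terms [k >= h] remain, and among them
    only [k = h] is not killed by [phi_h]. *)
Lemma deriv_orthonorm h (b : nat -> K) W : (h < W)%N ->
  'X^n * orthopoly A h = \sum_(k < W) b k *: orthopoly A k ->
  D (orthonorm A h) = b h * orthonorm A h.
Proof.
move=> hW bE; pose P := orthopoly A.
have high s : (s <= h)%N ->
    colform A s (\sum_(h <= k < W) b k *: P k) = (b h * orthonorm A h) *+ (s == h).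
  move=> sh; rewrite big_ltn // colformD colformZ colform_orthopoly // mulrnAr.
  suff -> : colform A s (\sum_(h.+1 <= k < W) b k *: P k) = 0 by rewrite addr0.
  rewrite -(add0n h.+1) big_addn big_mkord.
  rewrite (@colform_sum _ A s _ (fun k => b (k + h.+1)%N *: P (k + h.+1)%N)).
  rewrite big1 // => k _; rewrite colformZ colform_orthopoly //; last by lia.
  by rewrite (_ : (s == _) = false) ?mulr0 //; lia.
have split_sum : \sum_(k < W) b k *: P k =
    \sum_(k < h) b k *: P k + \sum_(h <= k < W) b k *: P k.
  by rewrite -!(big_mkord predT (fun k => b k *: P k)) (@big_cat_nat _ _ _ h) //= ltnW.
set lo := \sum_(k < h) b k *: P k in split_sum.
have DP : map_poly D (P h) + lo = 0.
  apply: (@colform_eq0 _ A h) => //.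
    apply/leq_sizeP => j hj; rewrite coefD coef_map_id0 //.
    move: hj; rewrite leq_eqVlt => /predU1P[<-|hj].
      rewrite coef_poly ltnSn gb_lower_diag // D1 add0r coef_sum big1 // => k _.
      by rewrite coefZ coef_poly ltnS leqNgt ltn_ord /= mulr0.
    rewrite coef_poly ltnS leqNgt hj /= D0 add0r coef_sum big1 // => k _.
    rewrite coefZ coef_poly ltnS leqNgt (_ : (k < j)%N) ?mulr0 //.
    exact: ltn_trans hj.
  move=> s sh; have := deriv_colform s (P h).
  rewrite colform_orthopoly ?(ltnW sh) // (ltn_eqF sh) mulr0n D0 bE split_sum.
  by rewrite !colformD high ?(ltnW sh) // (ltn_eqF sh) mulr0n addr0 addrC => <-.
have := deriv_colform h (P h); rewrite colform_orthopoly // eqxx mulr1n => ->.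
rewrite bE split_sum colformD high // eqxx mulr1n addrAC -colformD.
by rewrite [lo + _]addrC DP /colform size_poly0 big_ord0 add0r.
Qed.

End Derivation.

(** * Powers of the Lax operator *)

Section LaxPowers.
Variables (K : comNzRingType) (p q : nat) (c : nat -> K).
Hypothesis (hp : (1 <= p)%N) (hq : (1 <= q)%N).
Implicit Types (X : dop K) (k h : int).

Local Notation L := (lax_op p q c).
Local Notation E n := (dop_exp L n).

Definition site_coef h : K := if h is Posz n then c n else 0.

Lemma lax_opE k h :
  L k h = (k == q%:Z)%:R + (k == - p%:Z)%:R * site_coef h.
Proof.
rewrite /lax_op -/(site_coef h).
have [->|_] := eqVneq k q%:Z; last first.
  by case: (k == - p%:Z); rewrite ?mul1r ?mul0r add0r.
by rewrite (_ : (_ == _) = false) ?mul0r ?addr0 //; apply/eqP; lia.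
Qed.

Lemma fsbigT_pair (F : int -> K) a b : a != b ->
  (forall i, i != a -> i != b -> F i = 0) ->
  \sum_(i \in [set: int]) F i = F a + F b.
Proof.
move=> ab F0; rewrite -(@fsbig_widen _ _ _ _ [set` [:: a; b]] setT) //.
  by rewrite -fsbig_seq /= ?mem_seq1 ?ab // big_cons big_seq1.
move=> i [_ /= /negP]; rewrite !inE negb_or => /andP[ia ib]; exact: F0.
Qed.

Lemma dop_mul_laxl X k h :
  dop_mul L X k h = X (k - q%:Z) (h + q%:Z) + site_coef h * X (k + p%:Z) (h - p%:Z).
Proof.
have qp : q%:Z != - p%:Z by apply/eqP; lia.
rewrite /dop_mul (@fsbigT_pair _ q%:Z (- p%:Z)) //; last first.
  by move=> i iq ip; rewrite lax_opE (negbTE iq) (negbTE ip) mul0r addr0 mul0r.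
rewrite !lax_opE !eqxx (negbTE qp) eq_sym (negbTE qp).
by rewrite mul0r addr0 mul1r add0r mul1r opprK.
Qed.

Lemma dop_mul_laxr X k h :
  dop_mul X L k h =
    X (k - q%:Z) h + X (k + p%:Z) h * site_coef (h + k + p%:Z).
Proof.
have qp : k - q%:Z != k + p%:Z by apply/eqP; lia.
have qp' : q%:Z == - p%:Z = false by apply/eqP; lia.
rewrite /dop_mul (@fsbigT_pair _ (k - q%:Z) (k + p%:Z)) //; last first.
  move=> i iq ip; rewrite lax_opE.
  rewrite (_ : (k - i == q%:Z) = false); last by apply/eqP; move/eqP: iq; lia.
  rewrite (_ : (k - i == - p%:Z) = false); last by apply/eqP; move/eqP: ip; lia.
  by rewrite mul0r addr0 mulr0.
rewrite !lax_opE.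
rewrite (_ : k - (k - q%:Z) = q%:Z); last by lia.
rewrite (_ : k - (k + p%:Z) = - p%:Z); last by lia.
rewrite !eqxx qp' eq_sym qp' mul0r addr0 mulr1 add0r mul1r.
by congr (_ + _ * site_coef _); lia.
Qed.

Lemma dop_exp0 k h : E 0%N k h = (k == 0)%:R.
Proof. by []. Qed.

Lemma dop_expSl n k h : E n.+1 k h =
  E n (k - q%:Z) (h + q%:Z) + site_coef h * E n (k + p%:Z) (h - p%:Z).
Proof. exact: dop_mul_laxl. Qed.

(** The recursion of [dop_exp] multiplies by [L] on the left; this is the same
    recursion on the right, i.e. [L] commutes with its powers. *)
Lemma dop_expSr n k h : E n.+1 k h =
  E n (k - q%:Z) h + E n (k + p%:Z) h * site_coef (h + k + p%:Z).
Proof.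
elim: n k h => [|n IH] k h.
  rewrite dop_expSl !dop_exp0; have [kp|kp] := eqVneq (k + p%:Z) 0; last first.
    by rewrite mulr0 mul0r.
  by rewrite mulr1 mul1r (_ : h + k + p%:Z = h) //; lia.
rewrite dop_expSl [in LHS]IH [X in _ + _ * X]IH.
rewrite [X in _ = X + _]dop_expSl [X in _ = _ + X * _]dop_expSl.
rewrite (_ : h + q%:Z + (k - q%:Z) + p%:Z = h + k + p%:Z); last by lia.
rewrite (_ : h - p%:Z + (k + p%:Z) + p%:Z = h + k + p%:Z); last by lia.
rewrite (_ : k - q%:Z + p%:Z = k + p%:Z - q%:Z); last by lia.
by ring.
Qed.

(** Both shifts of [L] are congruent to [q] modulo [p + q]. *)
Lemma dop_exp_grading n k h :
  ~~ ((p + q)%:Z %| (k - q%:Z * n%:Z))%Z -> E n k h = 0.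
Proof.
elim: n k h => [|n IH] k h; first by
  rewrite mulr0 subr0 dop_exp0; case: eqP => // ->; rewrite dvdz0.
move=> nd; rewrite dop_expSl (IH (k - q%:Z)) ?(IH (k + p%:Z)) ?mulr0 ?addr0 //.
  apply: contra nd => e; rewrite -[k - _](addrK (p + q)%:Z) rpredB //.
  by move: e; congr (_ %| _)%Z; lia.
by apply: contra nd; congr (_ %| _)%Z; lia.
Qed.

(** For [k >= q] the truncation is invisible and the commutator is that of
    [L^N] with [L]; for [k < - p] it removes everything. In between, only the
    coefficient of [S^(k+p)] in [L^N] can contribute, with [0 <= k + p < p + q],
    and the grading leaves [k = - p]. *)
Lemma dop_comm_lax l k h :
  dop_comm (dop_pos (E ((p + q) * l))) L k h =
  if k == - p%:Z
  then site_coef h * (E ((p + q) * l) 0 h - E ((p + q) * l) 0 (h - p%:Z))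
  else 0.
Proof.
set N := ((p + q) * l)%N.
rewrite /dop_comm dop_mul_laxl dop_mul_laxr /dop_pos.
have [->|kp] := eqVneq k (- p%:Z).
  rewrite (_ : (0 <= - p%:Z - q%:Z) = false); last by lia.
  rewrite (_ : - p%:Z + p%:Z = 0); last by lia.
  rewrite (_ : h - p%:Z + p%:Z = h); last by lia.
  by rewrite lexx; ring.
have [kq|kq] := leP 0 (k - q%:Z).
  rewrite (_ : 0 <= k + p%:Z); last by lia.
  by rewrite -dop_expSl -dop_expSr subrr.
have [kp0|kp0] := leP 0 (k + p%:Z); last by ring.
have E0 s : E N (k + p%:Z) s = 0.
  apply: dop_exp_grading; apply/negP => /dvdzP[x] /(canRL (subrK _)).
  rewrite /N PoszM mulrA [q%:Z * _]mulrC -mulrA -[x * _]mulrC -mulrDr.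
  set y := x + _; have [y0|y0] := leP y 0 => e; last by nia.
  by move/eqP: kp; nia.
by rewrite !E0; ring.
Qed.

Hypothesis c_low : forall n, (n < p)%N -> c n = 0.

(** Multiplication by [x^q] acts on the [P_h] as the matrix of [L]. The vanishing
    of [c] below [p] keeps the negative sites out of the sum. *)
Lemma recurrence_exp (P : nat -> {poly K}) :
  (forall h : nat, 'X^q * P h = P (h + q)%N +
     (if (p <= h)%N then c h *: P (h - p)%N else 0)) ->
  forall n (h : nat) W, (h + q * n < W)%N ->
  'X^(q * n) * P h = \sum_(k < W) E n (k%:Z - h%:Z) h%:Z *: P k.
Proof.
move=> rec; elim=> [|n IH] h W hW.
  rewrite muln0 expr0 mul1r; have hW' : (h < W)%N by lia.
  rewrite (bigD1 (Ordinal hW')) //= big1 ?addr0 => [|k kh].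
    by rewrite dop_exp0 subrr eqxx scale1r.
  rewrite dop_exp0 subr_eq0 eqz_nat.
  by move: kh; rewrite -val_eqE /= => /negbTE ->; rewrite scale0r.
rewrite mulnSr exprD -mulrA rec mulrDr (IH _ W); last by lia.
have -> : 'X^(q * n) * (if (p <= h)%N then c h *: P (h - p)%N else 0) =
    \sum_(k < W) (c h * E n (k%:Z - h%:Z + p%:Z) (h%:Z - p%:Z)) *: P k.
  case: leqP => ph.
    rewrite -scalerAr (IH _ W); last by lia.
    rewrite scaler_sumr; apply: eq_bigr => k _; rewrite scalerA.
    by congr (_ * E n _ _ *: _); lia.
  rewrite mulr0 big1 // => k _; by rewrite c_low // mul0r scale0r.
rewrite -big_split; apply: eq_bigr => k _ /=; rewrite -scalerDl dop_expSl.
by congr ((E n _ _ + _) *: _); lia.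
Qed.

End LaxPowers.

Lemma fps_deriv0 r (K : fieldType) (l : 'I_r) : fps_deriv l (0 : fps r K) = 0.
Proof. by apply/funext => m; rewrite /fps_deriv mul0rn. Qed.

Lemma fps_deriv1 r (K : fieldType) (l : 'I_r) : fps_deriv l (1 : fps r K) = 0.
Proof.
apply/funext => m; rewrite /fps_deriv.
rewrite -[X in X *+ _]/((m + [ffun i => (i == l) : nat] == 0)%:R).
rewrite (_ : (_ == 0) = false) ?mul0rn //.
apply/eqP => /ffunP/(_ l); rewrite !ffunE eqxx => /eqP.
by rewrite -[_ == _]/(m l + 1 == 0)%N addn1.
Qed.

(** The Lax equation is a lattice equation on the coefficients: all its other
    components read [0 = 0]. *)
Lemma lax_solutionE (K : fieldType) (p q r : nat) (ell : 'I_r -> nat)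
    (c0 : nat -> K) (c : nat -> fps r K) : (1 <= p)%N -> (1 <= q)%N ->
  lax_solution p q ell c0 c <->
  (forall h, c h 0 = c0 h) /\
  (forall (l : 'I_r) (h : nat), fps_deriv l (c h) =
     c h * (dop_exp (lax_op p q c) ((p + q) * ell l) 0 h
          - dop_exp (lax_op p q c) ((p + q) * ell l) 0 (h%:Z - p%:Z))).
Proof.
move=> hp hq; have npq : (- p%:Z == q%:Z) = false by apply/eqP; lia.
split=> -[c0E lax]; split=> // l.
  move=> h; have := lax l (- p%:Z) h%:Z.
  rewrite dop_comm_lax // eqxx => <-; congr (fps_deriv l _).
  by rewrite lax_opE // npq eqxx add0r mul1r.
move=> k h; rewrite dop_comm_lax // lax_opE //.
have [->|kp] := eqVneq k (- p%:Z); last first.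
  rewrite mul0r addr0; case: eqP => _; [exact: fps_deriv1 | exact: fps_deriv0].
rewrite npq add0r mul1r.
by case: h => h /=; [exact: lax | rewrite fps_deriv0 mul0r].
Qed.

(** * Formal power series *)

Section Fps.
Variables (r : nat) (K : fieldType).
Implicit Types (f g h : fps r K) (m k : mindex r).

Lemma fpsD f g m : (f + g) m = f m + g m. Proof. by []. Qed.
Lemma fpsN f m : (- f) m = - f m. Proof. by []. Qed.
Lemma fps0 m : (0 : fps r K) m = 0. Proof. by []. Qed.
Lemma fps1 m : (1 : fps r K) m = (m == 0)%:R. Proof. by []. Qed.

Lemma fps_sum (I : Type) (s : seq I) (P : pred I) (F : I -> fps r K) m :
  (\sum_(i <- s | P i) F i) m = \sum_(i <- s | P i) F i m.
Proof.
by rewrite (big_morph (fun f : fps r K => f m) (fun f g => fpsD f g m) (fps0 m)).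
Qed.

Definition mdeg m : nat := \sum_i m i.

Lemma mdegD m k : mdeg (m + k) = (mdeg m + mdeg k)%N.
Proof. by rewrite /mdeg -big_split; apply: eq_bigr => i _; rewrite ffunE. Qed.

Lemma mdeg_ge m i : (m i <= mdeg m)%N.
Proof. by rewrite /mdeg (bigD1 i) //= leq_addr. Qed.

Definition unit_index (l : 'I_r) : mindex r := [ffun i => (i == l) : nat].

Lemma mdeg_unit_index l : mdeg (unit_index l) = 1%N.
Proof.
rewrite /mdeg (bigD1 l) //= ffunE eqxx big1 // => i il.
by rewrite ffunE (negbTE il).
Qed.

Lemma mdeg_eq0 m : mdeg m = 0%N -> m = 0.
Proof.
move=> m0; apply/ffunP => i; rewrite ffunE; apply/eqP.
by rewrite -leqn0 -m0 mdeg_ge.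
Qed.

Lemma mindex_sub_unit l m : (0 < m l)%N -> exists m', m = m' + unit_index l.
Proof.
move=> ml; exists [ffun i => (m i - (i == l))%N]; apply/ffunP => i.
rewrite !ffunE; have [->|_] := eqVneq i l; last by rewrite subn0 addr0.
by rewrite -[RHS]/((m l - 1) + 1)%N subnK.
Qed.

Lemma mindex_addI m : injective (+%R m).
Proof.
move=> k k' /ffunP e; apply/ffunP => i; have := e i; rewrite !ffunE.
exact: addnI.
Qed.

(** Boxes of multi-indices are finite types, which turns coefficients of
    products into sums over finite types. *)
Definition mbox (N : nat) := {ffun 'I_r -> 'I_N.+1}.
Definition mbox_val N (k : mbox N) : mindex r := [ffun i => k i : nat].

Lemma mbox_val_inj N : injective (@mbox_val N).
Proof.
by move=> k l /ffunP e; apply/ffunP => i; apply: val_inj; have := e i; rewrite !ffunE.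
Qed.

Lemma mbox_val_le N (k : mbox N) i : (mbox_val k i <= N)%N.
Proof. by rewrite ffunE -ltnS. Qed.

Lemma mboxP N m : (forall i, m i <= N)%N -> exists k : mbox N, mbox_val k = m.
Proof.
move=> mN; exists [ffun i => inord (m i)].
by apply/ffunP => i; rewrite !ffunE inordK ?ltnS.
Qed.

Lemma fpsM_box N f g m : (forall i, m i <= N)%N ->
  (f * g) m = \sum_(k : mbox N) \sum_(l : mbox N)
     (f (mbox_val k) * g (mbox_val l)) *+ (mbox_val k + mbox_val l == m).
Proof.
move=> mN; pose F u := f u.1 * g u.2 : K.
pose v (u : mbox N * mbox N) := (mbox_val u.1, mbox_val u.2).
have vI : injective v by move=> [a b] [c e] [] /mbox_val_inj -> /mbox_val_inj ->.
(* the definition sums over a set of pairs, here enumerated from the box *)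
transitivity (\sum_(u : mbox N * mbox N) F (v u) *+ ((v u).1 + (v u).2 == m));
  last by rewrite pair_big.
transitivity (\sum_(u <- [seq v u | u : mbox N * mbox N]) F u *+ (u.1 + u.2 == m));
  last by rewrite big_map big_enum.
rewrite -[LHS]/(\sum_(u \in [set u : mindex r * mindex r | u.1 + u.2 = m]) F u).
rewrite (eq_fsbigr (fun u => F u *+ (u.1 + u.2 == m))) => [|u]; last first.
  by rewrite inE /= => /eqP ->.
apply: fsbig_fwiden; last by move=> u /= [_ /eqP/negbTE ->]; rewrite mulr0n.
  move=> [a b] /= abm.
  have le (c : mindex r) : (exists e, c + e = m) -> exists k : mbox N, mbox_val k = c.
    by move=> [e ce]; apply: mboxP => i; apply: leq_trans (mN i);
       rewrite -ce ffunE leq_addr.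
  have [k ka] : exists k : mbox N, mbox_val k = a by apply: le; exists b.
  have [l lb] : exists l : mbox N, mbox_val l = b by apply: le; exists a; rewrite addrC.
  by apply/mapP; exists (k, l); rewrite ?mem_enum // /v ka lb.
by rewrite map_inj_uniq // enum_uniq.
Qed.

Definition eq_upto (d : nat) f g := forall m, (mdeg m <= d)%N -> f m = g m.

Lemma eq_uptoD d f f' g g' :
  eq_upto d f f' -> eq_upto d g g' -> eq_upto d (f + g) (f' + g').
Proof. by move=> ff gg m md; rewrite !fpsD ff ?gg. Qed.

Lemma eq_uptoN d f f' : eq_upto d f f' -> eq_upto d (- f) (- f').
Proof. by move=> ff m md; rewrite !fpsN ff. Qed.

Lemma eq_uptoM d f f' g g' :
  eq_upto d f f' -> eq_upto d g g' -> eq_upto d (f * g) (f' * g').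
Proof.
move=> ff gg m md; rewrite -[LHS]/(fps_mul f g m) -[RHS]/(fps_mul f' g' m).
apply: eq_fsbigr => -[k l]; rewrite inE /= => klm.
by move: md; rewrite -klm mdegD => md; rewrite ff ?gg //; lia.
Qed.

Lemma fpsM0 f g : (f * g) 0 = f 0 * g 0.
Proof.
rewrite (@fpsM_box 0) => [|i]; last by rewrite ffunE.
have z (k : mbox 0) : mbox_val k = 0.
  by apply/ffunP => i; rewrite ffunE (ord1 (k i)) ffunE.
have c1 : #|mbox 0| = 1%N by rewrite card_ffun card_ord exp1n.
under eq_bigr do under eq_bigr do rewrite !z addr0 eqxx mulr1n.
by rewrite !sumr_const [#|_|]c1.
Qed.

(** Named so that it can carry the structure of a ring morphism, which computes
    the constant term of a determinant. *)
Definition fps_ev0 (f : fps r K) : K := f 0.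

Lemma fps_ev0_is_zmod_morphism : zmod_morphism fps_ev0.
Proof. by []. Qed.

Lemma fps_ev0_is_monoid_morphism : monoid_morphism fps_ev0.
Proof. by split; [rewrite /fps_ev0 fps1 eqxx | exact: fpsM0]. Qed.

HB.instance Definition _ :=
  GRing.isZmodMorphism.Build (fps r K) K fps_ev0 fps_ev0_is_zmod_morphism.
HB.instance Definition _ :=
  GRing.isMonoidMorphism.Build (fps r K) K fps_ev0 fps_ev0_is_monoid_morphism.

Lemma fpsX_low f n m : f 0 = 0 -> (mdeg m < n)%N -> (f ^+ n) m = 0.
Proof.
move=> f0; elim: n m => [//|n IH] m mn.
rewrite exprS -[LHS]/(fps_mul f (f ^+ n) m) /fps_mul fsbig1 // => -[k l] /= klm.
have [k0|k0] := posnP (mdeg k); first by rewrite (mdeg_eq0 k0) f0 mul0r.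
by rewrite IH ?mulr0 //; move: mn; rewrite -klm mdegD; lia.
Qed.

(** The geometric series [1 / (1 - f)] for [f] without constant term: powers
    above the degree of a multi-index do not contribute to its coefficient. *)
Definition fps_geom f : fps r K := fun m => \sum_(n < (mdeg m).+1) (f ^+ n) m.

Lemma fps_geom_upto f N : f 0 = 0 ->
  eq_upto N (fps_geom f) (\sum_(n < N.+1) f ^+ n).
Proof.
move=> f0 m mN; rewrite fps_sum /fps_geom.
rewrite -!(big_mkord predT (fun n => (f ^+ n) m)).
rewrite [RHS](@big_cat_nat _ _ _ (mdeg m).+1) //= [X in _ + X]big_nat_cond.
by rewrite [X in _ + X]big1 ?addr0 // => i /andP[/andP[mi _] _]; rewrite fpsX_low.
Qed.

Lemma fps_geomE f : f 0 = 0 -> (1 - f) * fps_geom f = 1.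
Proof.
move=> f0; apply/funext => m.
rewrite (@eq_uptoM (mdeg m) _ (1 - f) _ (\sum_(n < (mdeg m).+1) f ^+ n)) //;
  last exact: fps_geom_upto.
by rewrite -[1 - f]opprB mulNr -subrX1 opprB fpsD fpsN fpsX_low // subr0.
Qed.

(** Up to its constant term, [f] is [1 - g] with [g] without constant term. *)
Lemma fps_unitP f : (f \is a GRing.unit) = (f 0 != 0).
Proof.
apply/idP/idP => [uf|f0].
  have : fps_ev0 f \is a GRing.unit by exact: rmorph_unit.
  by rewrite unitfE.
pose C : fps r K := fun m => if m == 0 then (f 0)^-1 else 0.
have g0 : (1 - C * f) 0 = 0.
  by rewrite fpsD fpsN fpsM0 /C fps1 eqxx mulVf // subrr.
have e : fps_geom (1 - C * f) * C * f = 1.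
  by have := fps_geomE g0; rewrite subKr mulrC mulrA.
by apply/unitrP; exists (fps_geom (1 - C * f) * C); split=> //; rewrite mulrC.
Qed.

Section Deriv.
Variable l : 'I_r.

Lemma fps_derivE f m : fps_deriv l f m = f (m + unit_index l) *+ (m l).+1.
Proof. by []. Qed.

Lemma fps_derivD f g : fps_deriv l (f + g) = fps_deriv l f + fps_deriv l g.
Proof. by apply/funext => m; rewrite fpsD !fps_derivE mulrnDl. Qed.

(* The Leibniz rule is immediate for theta = t_l d/dt_l, which does not move the
   monomials; the factor t_l is then cancelled. *)
Let X : fps r K := fun m => (m == unit_index l)%:R.
Let theta f : fps r K := fun m => f m *+ m l.

Let XM f m : (X * f) (m + unit_index l) = f m.
Proof.
rewrite -[LHS]/(fps_mul X f _) /fps_mul.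
rewrite -(@fsbig_widen _ _ _ _ [set (unit_index l, m)]) /=; first last.
- move=> [a b] /= [abm ne]; rewrite /X; case: eqVneq => [al|]; last by rewrite mul0r.
  by case: ne; congr (_, _) => //; apply: (@mindex_addI a); rewrite abm al addrC.
- by move=> [a b] [-> ->] /=; rewrite addrC.
by rewrite fsbig_set1 /X eqxx mul1r.
Qed.

Let XderivE f : X * fps_deriv l f = theta f.
Proof.
apply/funext => m; have [ml|ml] := posnP (m l).
  rewrite /theta ml mulr0n -[LHS]/(fps_mul X _ m) /fps_mul fsbig1 // => -[a b] /= abm.
  rewrite /X; case: eqVneq => [al|]; last by rewrite mul0r.
  by move: ml; rewrite -abm al !ffunE eqxx.
have [m' ->] := mindex_sub_unit ml; rewrite XM /theta fps_derivE !ffunE eqxx.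
by rewrite -[(m' l + _)%R]/(m' l + 1)%N addn1.
Qed.

Let thetaM f g : theta (f * g) = theta f * g + f * theta g.
Proof.
apply/funext => m; rewrite fpsD /theta.
rewrite !(fpsM_box _ _ (@mdeg_ge m)).
rewrite -sumrMnl -big_split; apply: eq_bigr => a _ /=.
rewrite -sumrMnl -big_split; apply: eq_bigr => b _ /=.
have [abm|_] := eqVneq; last by rewrite !mulr0n mul0rn addr0.
rewrite !mulr1n mulrnAl mulrnAr -mulrnDr; congr (_ *+ _).
by rewrite -[in LHS]abm ffunE.
Qed.

Lemma fps_derivM f g :
  fps_deriv l (f * g) = fps_deriv l f * g + f * fps_deriv l g.
Proof.
apply/funext => m; have e h : fps_deriv l h m = theta h (m + unit_index l).
  by rewrite /theta fps_derivE !ffunE eqxx -[(m l + _)%R]/(m l + 1)%N addn1.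
rewrite e thetaM -!XderivE -[RHS]XM mulrDr; congr ((_ + _) _).
  by rewrite mulrA.
by rewrite mulrCA.
Qed.

End Deriv.

End Fps.

(** * Moments at time zero *)

Section TauFromPolys.
Variables (K : fieldType) (A : smx K).

(** The coefficients of the [Q h] form a unit lower triangular matrix whose
    product with [A] is upper triangular. *)
Lemma tau_prod (Q : nat -> {poly K}) N :
  (forall h, (size (Q h) <= h.+1)%N) -> (forall h, (Q h)`_h = 1) ->
  (forall h s, (s < h)%N -> colform A s (Q h) = 0) ->
  tau A N = \prod_(h < N) colform A h (Q h).
Proof.
move=> szQ Q1 Q0; pose S : 'M[K]_N := \matrix_(h, j) (Q h)`_j.
have SA h s : (S *m leading N A) h s = colform A s (Q h).
  rewrite (colform_wide A s (leq_trans (szQ h) (ltn_ord h))) mxE.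
  by apply: eq_bigr => j _; rewrite !mxE.
have detS : \det S = 1.
  rewrite det_trig; first by rewrite big1 // => i _; rewrite mxE Q1.
  by apply/is_trig_mxP => i j ij; rewrite mxE nth_default // (leq_trans (szQ i)).
rewrite /tau -[LHS]mul1r -[X in X * _]detS -det_mulmx -det_tr det_trig.
  by apply: eq_bigr => i _; rewrite mxE SA.
by apply/is_trig_mxP => i j ij; rewrite mxE SA Q0.
Qed.

End TauFromPolys.

Section InitialMoments.
Variables (K : fieldType) (p q : nat) (c : nat -> K).
Hypothesis (hp : (1 <= p)%N) (hq : (1 <= q)%N).
Hypothesis c_low : forall h, (h < p)%N -> c h = 0.
Hypothesis c_neq0 : forall h, (p <= h)%N -> c h != 0.

Local Notation H := (hess p q c).

Lemma smx_expS n h i : smx_exp H n.+1 h i =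
  smx_exp H n (h + q)%N i + (if (p <= h)%N then c h * smx_exp H n (h - p)%N i else 0).
Proof.
rewrite -[LHS]/(smx_mul H (smx_exp H n) h i) /smx_mul.
rewrite -(@fsbig_widen _ _ _ _ [set` [:: (h + q)%N; (h - p)%N]] setT) //; last first.
  move=> k [_ /= /negP]; rewrite !inE negb_or => /andP[kq kp].
  rewrite /hess (negbTE kq); case: eqP => hk; last by rewrite mul0r.
  by move: kp; rewrite hk addnK eqxx.
rewrite -fsbig_seq /= ?mem_seq1 ?andbT; last by apply/eqP; lia.
rewrite big_cons big_seq1 /hess eqxx mul1r.
rewrite (_ : (h - p == h + q)%N = false); last by lia.
rewrite [h == _](_ : _ = (p <= h)%N); last by lia.
by case: ifP => //; rewrite mul0r.
Qed.

Lemma smx_exp_band n h i : (i + p * n < h)%N -> smx_exp H n h i = 0.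
Proof.
elim: n h => [|n IH] h hi; first by rewrite /smx_exp /= (_ : (h == i) = false) //; lia.
rewrite smx_expS IH; last by lia.
by rewrite add0r; case: leqP => // ph; rewrite IH ?mulr0 //; lia.
Qed.

(** The lowest diagonal of [H^n] is a product of coefficients of [H]. *)
Lemma smx_exp_edgeS n i :
  smx_exp H n.+1 (i + p * n.+1)%N i = c (i + p * n.+1)%N * smx_exp H n (i + p * n)%N i.
Proof.
rewrite smx_expS smx_exp_band ?add0r; last by lia.
rewrite (_ : p <= i + p * n.+1)%N; last by lia.
by rewrite (_ : (i + p * n.+1 - p) = i + p * n)%N //; lia.
Qed.

Lemma smx_exp_edge n i : smx_exp H n (i + p * n)%N i != 0.
Proof.
elim: n => [|n IH]; first by rewrite muln0 addn0 /smx_exp /= eqxx oner_eq0.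
by rewrite smx_exp_edgeS mulf_neq0 // c_neq0 //; lia.
Qed.

Lemma smx_exp_grading n h i : (h + q * n != i %[mod p + q])%N -> smx_exp H n h i = 0.
Proof.
elim: n h => [|n IH] h.
  by rewrite muln0 addn0 /smx_exp /=; have [->|//] := eqVneq h i; rewrite eqxx.
move=> ne; rewrite smx_expS IH; last by rewrite -addnA -mulnS.
rewrite add0r; case: leqP => // ph; rewrite IH ?mulr0 //; apply: contra ne.
rewrite (_ : (h + q * n.+1)%N = (h - p + q * n + (p + q))%N) ?modnDr //.
by rewrite mulnS; lia.
Qed.

Definition initial_moments : smx K :=
  step_line p q (fun n j i => smx_exp H n j i).

Local Notation A := initial_moments.

Lemma initial_momentsE r s : A r s = smx_exp H (r %/ q + s %/ p)%N (r %% q)%N (s %% p)%N.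
Proof. by []. Qed.

(** The polynomials with [Q_j = x^j] for [j < q] and
    [Q_(h+q) = x^q Q_h - c_h Q_(h-p)]: their moments satisfy the recursion of the
    rows of [H^n]. *)
Lemma initial_polys (h : nat) : exists Q : {poly K},
  [/\ (size Q <= h.+1)%N, Q`_h = 1
    & forall s, colform A s Q = smx_exp H (s %/ p)%N h (s %% p)%N].
Proof.
elim/ltn_ind: h => h IH; have [hq'|qh] := ltnP h q.
  exists 'X^h; split; first by rewrite size_polyXn.
    by rewrite coefXn eqxx.
  move=> s; rewrite -['X^h]mulr1 colform_XnM size_poly1 big_ord1 coef1 eqxx mul1r.
  by rewrite addn0 initial_momentsE divn_small // modn_small.
have [|Q [szQ Q1 QE]] := IH (h - q)%N; first by lia.
have XQ s : colform A s ('X^q * Q) = smx_exp H (s %/ p)%N.+1 (h - q)%N (s %% p)%N.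
  rewrite colform_XnM (_ : (s %/ p)%N.+1 = (s + p) %/ p)%N; last first.
    by rewrite divnDr // divnn hp addn1.
  rewrite (_ : s %% p = (s + p) %% p)%N; last by rewrite modnDr.
  rewrite -QE /colform; apply: eq_bigr => r _; rewrite !initial_momentsE.
  rewrite divnDl // divnn hq modnDl divnDr // divnn hp modnDr.
  by congr (_ * smx_exp _ _ _ _); lia.
have szXQ : (size ('X^q * Q : {poly K})%R <= h.+1)%N.
  apply: leq_trans (size_polyMleq _ _) _; rewrite size_polyXn addSn /=.
  by rewrite -(subnKC qh) -addnS leq_add2l.
have XQ1 : ('X^q * Q)`_h = 1 by rewrite coefXnM ltnNge qh.
have [ph|ph] := leqP p (h - q)%N; last first.
  exists ('X^q * Q); split=> // s.
  by rewrite XQ smx_expS leqNgt ph /= addr0 subnK.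
have [|Q' [szQ' _ QE']] := IH (h - q - p)%N; first by lia.
exists ('X^q * Q - c (h - q)%N *: Q'); split.
- apply: leq_trans (size_polyD _ _) _; rewrite size_polyN geq_max szXQ /=.
  by apply: leq_trans (size_scale_leq _ _) _; lia.
- rewrite coefB XQ1 coefZ [Q'`_h]nth_default ?mulr0 ?subr0 //.
  by apply: leq_trans szQ' _; lia.
- move=> s; rewrite colformB colformZ XQ QE' smx_expS ph subnK //.
  by rewrite addrK.
Qed.

Let Q h := projT1 (cid (initial_polys h)).
Let szQ h : (size (Q h) <= h.+1)%N. Proof. by rewrite /Q; case: cid => ? []. Qed.
Let Q1 h : (Q h)`_h = 1. Proof. by rewrite /Q; case: cid => ? []. Qed.
Let QE h s : colform A s (Q h) = smx_exp H (s %/ p)%N h (s %% p)%N.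
Proof. by rewrite /Q; case: cid => ? []. Qed.

(* the band of H^n gives the orthogonality: for s < h the row h lies below it *)
Let tauE N : tau A N = \prod_(h < N) smx_exp H (h %/ p)%N h (h %% p)%N.
Proof.
rewrite (tau_prod N szQ Q1) => [|h s sh].
  by apply: eq_bigr => h _; rewrite QE.
by rewrite QE smx_exp_band // addnC mulnC -divn_eq.
Qed.

Let edge h : smx_exp H (h %/ p)%N h (h %% p)%N != 0.
Proof.
rewrite [X in smx_exp _ _ X](divn_eq h p) addnC mulnC; exact: smx_exp_edge.
Qed.

Lemma tau_initial_neq0 N : tau A N != 0.
Proof. by rewrite tauE; apply/prodf_neq0 => h _. Qed.

Lemma tau_ratio_initial h : (p <= h)%N -> tau_ratio p A h = c h.
Proof.
move=> ph; rewrite /tau_ratio.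
have tauS n : tau A n.+1 = tau A n * smx_exp H (n %/ p)%N n (n %% p)%N.
  by rewrite !tauE big_ord_recr.
have e : smx_exp H (h %/ p)%N h (h %% p)%N =
    c h * smx_exp H ((h - p) %/ p)%N (h - p)%N ((h - p) %% p)%N.
  have [h' hE] : exists h', h = (h' + p)%N by exists (h - p)%N; rewrite subnK.
  rewrite hE addnK divnDr // divnn hp addn1 modnDr.
  have := smx_exp_edgeS (h' %/ p)%N (h' %% p)%N.
  rewrite mulnS [(p + _)%N]addnC addnA ![(h' %% p + _)%N]addnC [(p * _)%N]mulnC.
  by rewrite -divn_eq.
rewrite !tauS e; have := tau_initial_neq0 h; have := tau_initial_neq0 (h - p)%N.
by have := edge (h - p)%N; move=> *; field; do !(apply/andP; split).
Qed.

End InitialMoments.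

(** * Formal solution of the Lax equations *)

Section FormalMoments.
Variables (K : numFieldType) (p q r : nat) (ell : 'I_r -> nat) (c0 : nat -> K).
Hypothesis (hp : (1 <= p)%N) (hq : (1 <= q)%N).

Local Notation H := (hess p q c0).
Local Notation A := (formal_moment_matrix p q ell H).

Lemma star_functional_monomial (B : smx K) j i a n :
  star_functional B j i (a *: 'X^n) = a * smx_exp B n j i.
Proof.
rewrite /star_functional; have [->|a0] := eqVneq a 0.
  by rewrite scale0r size_poly0 big_ord0 mul0r.
rewrite size_scale // size_polyXn big_ord_recr /= big1 ?add0r => [|k _].
  by rewrite coefZ coefXn eqxx mulr1.
by rewrite coefZ coefXn (ltn_eqF (ltn_ord k)) mulr0 mul0r.
Qed.

Definition mfact (m : mindex r) : K := \prod_l (m l)`!%:R.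
Definition mshift (m : mindex r) : nat := ((p + q) * \sum_l ell l * m l)%N.

Lemma formal_pairingE n j i m :
  formal_pairing p q ell H n j i m =
  (mfact m)^-1 * smx_exp H (n + mshift m) j i.
Proof.
by rewrite /formal_pairing /exp_coef -scalerAr -exprD star_functional_monomial.
Qed.

Lemma mfactS m l : mfact (m + unit_index l) = (m l).+1%:R * mfact m.
Proof.
rewrite /mfact (bigD1 l) //= [in RHS](bigD1 l) //= mulrA; congr (_ * _).
  by rewrite !ffunE eqxx -[(m l + _)%R]/(m l + 1)%N addn1 factS natrM.
by apply: eq_bigr => i il; rewrite !ffunE (negbTE il) addr0.
Qed.

Lemma mshiftS m l : mshift (m + unit_index l) = ((p + q) * ell l + mshift m)%N.
Proof.
rewrite /mshift -mulnDr; congr (_ * _)%N.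
rewrite (bigD1 l) //= [in RHS](bigD1 l) //= addnA; congr (_ + _)%N.
  by rewrite !ffunE eqxx -[(m l + _)%R]/(m l + 1)%N mulnDr muln1 addnC.
by apply: eq_bigr => i il; rewrite !ffunE (negbTE il) addr0.
Qed.

(** The exponential [E_t] satisfies [dE/dt_l = lambda^((p + q) l) E]. *)
Lemma fps_deriv_pairing l n j i :
  fps_deriv l (formal_pairing p q ell H n j i) =
  formal_pairing p q ell H (n + (p + q) * ell l) j i.
Proof.
apply/funext => m; rewrite fps_derivE !formal_pairingE mfactS mshiftS addnA.
by rewrite -[LHS]mulr_natl invfM !mulrA divff ?pnatr_eq0 // mul1r.
Qed.

Lemma formal_moments0 i j : fps_ev0 (A i j) = initial_moments p q c0 i j.
Proof.
rewrite /fps_ev0 /formal_moment_matrix /step_line formal_pairingE.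
rewrite /mfact big1 ?invr1 ?mul1r => [|l _]; last by rewrite ffunE.
by rewrite /mshift big1 ?muln0 ?addn0 // => l _; rewrite ffunE muln0.
Qed.

Lemma tau_formal0 N : fps_ev0 (tau A N) = tau (initial_moments p q c0) N.
Proof.
rewrite /tau -det_map_mx; congr (\det _); apply/matrixP => i j.
by rewrite !mxE -formal_moments0.
Qed.

Lemma formal_moments_shift i j : A (q + i)%N j = A i (j + p)%N.
Proof.
rewrite /formal_moment_matrix /step_line.
rewrite divnDl // divnn hq modnDl divnDr // divnn hp modnDr.
by congr formal_pairing; lia.
Qed.

Lemma fps_deriv_moments l i j :
  fps_deriv l (A i j) = A (q * ((p + q) * ell l) + i)%N j.
Proof.
rewrite /formal_moment_matrix /step_line fps_deriv_pairing.
rewrite [(q * _)%N]mulnC divnMDl // modnMDl.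
by congr formal_pairing; lia.
Qed.

(** A nonzero entry [(u, v)] of [H^n] has [u + q n] congruent to [v] modulo
    [p + q]. Here [u], [v] are the remainders of [i] by [q] and of [j] by [p], and
    [n] is the sum of the quotients up to a multiple of [p + q]; as [q] is
    congruent to [- p], this makes [i] congruent to [j]. *)
Lemma formal_moments_grading i j : i != j %[mod p + q] -> A i j = 0.
Proof.
move=> ij; apply/funext => m; rewrite /formal_moment_matrix /step_line.
rewrite formal_pairingE smx_exp_grading ?mulr0 //; apply: contra ij => /eqP e.
have iE : (i %% q + q * (i %/ q + j %/ p + mshift m) + j %/ p * p =
           (j %/ p + q * \sum_l ell l * m l) * (p + q) + i)%N.
  by rewrite [in RHS](divn_eq i q) /mshift; ring.
by rewrite -(modnMDl (j %/ p + q * \sum_l ell l * m l)) -iE -modnDml e modnDml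
  addnC -divn_eq.
Qed.

Hypothesis c0_low : forall h, (h < p)%N -> c0 h = 0.
Hypothesis c0_neq0 : forall h, (p <= h)%N -> c0 h != 0.

Lemma tau_formal_unit N : tau A N \is a GRing.unit.
Proof.
by rewrite fps_unitP -[tau A N 0]/(fps_ev0 _) tau_formal0 tau_initial_neq0.
Qed.

Definition formal_coef (h : nat) : fps r K :=
  if (h < p)%N then 0 else tau_ratio p A h.

Lemma formal_coef_low h : (h < p)%N -> formal_coef h = 0.
Proof. by rewrite /formal_coef => ->. Qed.

Lemma formal_coef0 h : formal_coef h 0 = c0 h.
Proof.
rewrite /formal_coef; case: ltnP => ph; first by rewrite c0_low.
rewrite -(@tau_ratio_initial K p q c0) //.
rewrite -[LHS]/(fps_ev0 _) /tau_ratio rmorphM rmorphV ?rmorphM ?unitrM ?tau_formal_unit //.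
by congr (_ * _ / (_ * _)); exact: tau_formal0.
Qed.

Lemma formal_coef_orthonorm h : (p <= h)%N ->
  orthonorm A h = formal_coef h * orthonorm A (h - p).
Proof.
move=> ph; rewrite /formal_coef ltnNge ph /= /tau_ratio /orthonorm.
rewrite invrM ?tau_formal_unit // [tau A (h - p) * _]mulrC -!mulrA.
rewrite mulKr ?tau_formal_unit // [tau A (h - p) * _]mulrCA.
by rewrite divrr ?tau_formal_unit // mulr1.
Qed.

(** The logarithmic derivative of [d_h] is the diagonal coefficient of the power
    of [L], and [c_h] is a quotient of two of the [d_h]. *)
Lemma formal_coef_solution : lax_solution p q ell c0 formal_coef.
Proof.
apply/lax_solutionE => //; split=> [|l h]; first exact: formal_coef0.
set E := dop_exp _ _.
have dE n : fps_deriv l (orthonorm A n) = E 0 n%:Z * orthonorm A n.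
  pose W := (n + q * ((p + q) * ell l)).+1.
  rewrite -(subrr n%:Z).
  apply: (@deriv_orthonorm _ A _ (q * ((p + q) * ell l)) tau_formal_unit
            _ _ _ _ (fun k => E (k%:Z - n%:Z) n%:Z) W).
  - exact: fps_derivD.
  - exact: fps_derivM.
  - exact: fps_deriv_moments.
  - by rewrite /W; lia.
  - apply: (@recurrence_exp _ p q) => //; first exact: formal_coef_low.
    move=> k; rewrite (@orthopoly_recurrence _ p q) //.
    + by congr (_ + _); case: leqP => // pk; rewrite /formal_coef ltnNge pk.
    + exact: tau_formal_unit.
    + exact: formal_moments_shift.
    + exact: formal_moments_grading.
    + by lia.
have [ph|hp'] := ltnP h p; first by rewrite formal_coef_low // fps_deriv0 mul0r.
have uu : orthonorm A (h - p) \is a GRing.unit.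
  by rewrite unitrM unitrV !tau_formal_unit.
have := dE h; rewrite formal_coef_orthonorm // fps_derivM dE => e.
apply: (mulIr uu); rewrite (subzn hp') mulrBr mulrBl.
rewrite -!mulrA [X in _ = X - _]mulrCA -e.
by rewrite addrK.
Qed.

Lemma dop_exp_upto d (c c' : nat -> fps r K) n k h :
  (forall i, eq_upto d (c i) (c' i)) ->
  eq_upto d (dop_exp (lax_op p q c) n k h) (dop_exp (lax_op p q c') n k h).
Proof.
move=> cc; elim: n k h => [|n IH] k h; first by rewrite !dop_exp0.
rewrite !(dop_expSl _ hp hq); apply: eq_uptoD; first exact: IH.
apply: eq_uptoM; last exact: IH.
by case: h => i; [exact: cc | move=> m _].
Qed.

(** The right-hand side of the Lax equation up to degree [d] depends on the
    coefficients up to degree [d] only, and in characteristic zero it determines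
    those of degree [d + 1]. *)
Lemma lax_solution_unique (c c' : nat -> fps r K) :
  lax_solution p q ell c0 c -> lax_solution p q ell c0 c' -> c = c'.
Proof.
move=> /lax_solutionE[] // ci cd /lax_solutionE[] // ci' cd'.
suff cc d : forall h, eq_upto d (c h) (c' h).
  by apply/funext => h; apply/funext => m; exact: (cc (mdeg m)).
elim: d => [|d IH] h m md.
  by rewrite (mdeg_eq0 (m := m)) ?ci ?ci' //; apply/eqP; rewrite -leqn0.
have [m0|m0] := eqVneq m 0; first by rewrite m0 ci ci'.
have [l ml] : exists l, (0 < m l)%N.
  apply/existsP; apply: contraNT m0; rewrite negb_exists => /forallP m0.
  by apply/eqP/ffunP => l; rewrite ffunE; apply/eqP; rewrite -leqn0 leqNgt.
have [m' mE] := mindex_sub_unit ml; rewrite mE in md *.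
have md' : (mdeg m' <= d)%N by move: md; rewrite mdegD mdeg_unit_index; lia.
have : fps_deriv l (c h) m' = fps_deriv l (c' h) m'.
  rewrite cd cd'; apply: (eq_uptoM (d := d)); [exact: IH | | exact: md'].
  by apply: eq_uptoD; [|apply: eq_uptoN]; apply: dop_exp_upto.
rewrite !fps_derivE -[LHS]mulr_natr -[RHS]mulr_natr.
by apply: mulIf; rewrite pnatr_eq0.
Qed.

End FormalMoments.

(** * Convergent power series *)

Section Boxes.
Variable L : nat.
Implicit Types (m : mindex L) (A B : {fset mindex L}).

(** The boxes again, as members of the directed set along which families are
    summed. *)
Definition box_fset (N : nat) : {fset mindex L} :=
  [fset m in [seq mbox_val k | k : mbox L N]]%fset.

Lemma box_fsetP N m : reflect (forall i, (m i <= N)%N) (m \in box_fset N).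
Proof.
rewrite inE /=; apply: (iffP mapP) => [[k _ ->] i|mN]; first exact: mbox_val_le.
by have [k <-] := mboxP mN; exists k; rewrite ?mem_enum.
Qed.

Lemma box_fset_sub (A : {fset mindex L}) : exists N, (A `<=` box_fset N)%fset.
Proof.
exists (\max_(m <- A) mdeg m)%N; apply/fsubsetP => m mA; apply/box_fsetP => i.
by apply: leq_trans (mdeg_ge m i) _; exact: (@leq_bigmax_seq _ _ predT (@mdeg L)).
Qed.

Lemma notin_box_fset N m : m \notin box_fset N -> (N < mdeg m)%N.
Proof.
move=> /box_fsetP mN; rewrite ltnNge; apply/negP => mN'; apply: mN => i.
exact: leq_trans (mdeg_ge m i) mN'.
Qed.

Lemma sum_box_fset (V : nmodType) N (f : mindex L -> V) :
  \sum_(m <- box_fset N) f m = \sum_(k : mbox L N) f (mbox_val k).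
Proof.
rewrite -(big_map (@mbox_val L N) predT f).
apply: perm_big; apply: uniq_perm; rewrite ?fset_uniq //.
  by rewrite map_inj_uniq ?index_enum_uniq //; exact: mbox_val_inj.
by move=> m; rewrite inE /=; apply/mapP/mapP => -[k _ ->]; exists k;
   rewrite ?mem_enum ?mem_index_enum.
Qed.

Lemma sum_fset_split (V : nmodType) (A B : {fset mindex L}) (f : mindex L -> V) :
  (A `<=` B)%fset ->
  \sum_(m <- B) f m = \sum_(m <- A) f m + \sum_(m <- [fset m in B | m \notin A]%fset) f m.
Proof.
move=> /fsubsetP AB; rewrite (big_fsetID _ (mem A)) /=; congr (_ + _).
apply: eq_fbigl => m; rewrite !inE /=; apply/andP/idP => [[]//|mA].
by rewrite mA AB.
Qed.

Lemma mem_fset_diff A B m :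
  (m \in [fset m in B | m \notin A]%fset) = (m \in B) && (m \notin A).
Proof. by rewrite !inE. Qed.

End Boxes.

Section Series.
Variables (R : realType) (L : nat).
Local Notation C := R[i].
Local Notation T := 'rV[C]_L.
Implicit Types (F G : fps L C) (t : T) (m : mindex L).

Lemma half_expn_lt (e : C) : 0 < e -> exists n, 2^-1 ^+ n < e.
Proof.
case: e => x y; rewrite ltcE /= => /andP[/eqP -> x0].
pose n := Num.bound x^-1; exists n.
have xn : x^-1 < 2 ^+ n.
  apply: lt_trans (archi_boundP _) _; first by rewrite invr_ge0 ltW.
  by rewrite -natrX ltr_nat ltn_expl.
rewrite -[_ +i* 0]/(x%:C) exprVn.
have -> : (2 ^+ n)^-1 = ((2 ^+ n)^-1)%:C :> C.
  by rewrite fmorphV rmorphXn rmorph_nat.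
by rewrite ltcR -[x]invrK ltf_pV2 // posrE ?exprn_gt0 // invr_gt0.
Qed.

Lemma cvg_half_bound (u : nat -> C) (z : C) (B : C) :
  (forall n, `|u n - z| <= B * 2^-1 ^+ n) -> u @ \oo --> z.
Proof.
move=> uB; apply/cvgrPdist_lt => e e0.
have B0 : 0 <= B by have := uB 0%N; rewrite expr0 mulr1; exact: le_trans.
have [n ne] : exists n, 2^-1 ^+ n < e / (B + 1).
  by apply: half_expn_lt; rewrite divr_gt0 // ltr_wpDl.
exists n => // k /= nk; rewrite distrC; apply: le_lt_trans (uB k) _.
apply: le_lt_trans (_ : (B + 1) * 2^-1 ^+ n < e); last first.
  by rewrite mulrC -ltr_pdivlMr // ltr_wpDl.
rewrite ler_pM ?exprn_ge0 ?invr_ge0 // ?lerDl //.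
by rewrite ler_wiXn2l // ?invr_ge0 // invf_le1 // ler1n.
Qed.

Definition monomial t m : C := \prod_l t 0 l ^+ m l.

Definition box_sum F t (N : nat) : C :=
  \sum_(k : mbox L N) F (mbox_val k) * monomial t (mbox_val k).

(** The weighted l^1-norm of [F] at the polyradius [2^-n] is at most [B]. With
    powers of two as radii, shrinking a polydisc is an increment of [n]. *)
Definition norm_le (n : nat) (B : C) F := forall N,
  \sum_(k : mbox L N) `|F (mbox_val k)| * 2^-1 ^+ (n * mdeg (mbox_val k)) <= B.

Definition in_polydisc (n : nat) t := forall l, `|t 0 l| <= 2^-1 ^+ n.

(** [F] converges to [f] on some polydisc, with a bound on the norm that makes
    this stable under products and inverses. *)
Definition represents F (f : T -> C) := exists n B,
  norm_le n B F /\ forall t, in_polydisc n t -> box_sum F t @ \oo --> f t.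

Let h01 n : 0 <= 2^-1 ^+ n :> C. Proof. by rewrite exprn_ge0 // invr_ge0. Qed.
Let hle n k : (n <= k)%N -> 2^-1 ^+ k <= 2^-1 ^+ n :> C.
Proof. by move=> nk; rewrite ler_wiXn2l // ?invr_ge0 // invf_le1 // ler1n. Qed.

Lemma monomialD t m m' : monomial t (m + m') = monomial t m * monomial t m'.
Proof.
by rewrite /monomial -big_split; apply: eq_bigr => l _; rewrite ffunE exprD.
Qed.

Lemma monomial_le n t m : in_polydisc n t ->
  `|monomial t m| <= 2^-1 ^+ (n * mdeg m).
Proof.
move=> tn; rewrite /monomial normr_prod /mdeg big_distrr -prodrXr /=.
rewrite ler_prod // => l _; rewrite normr_ge0 normrX exprM.
by rewrite lerXn2r ?nnegrE.
Qed.

Lemma in_polydiscS n k t : (n <= k)%N -> in_polydisc k t -> in_polydisc n t.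
Proof. by move=> nk tk l; apply: le_trans (tk l) (hle nk). Qed.

Lemma norm_leS n k B F : (n <= k)%N -> norm_le n B F -> norm_le k B F.
Proof.
move=> nk FB N; apply: le_trans (FB N); apply: ler_sum => m _.
by rewrite ler_wpM2l // hle // leq_mul.
Qed.

Lemma norm_sum_ge0 F n N :
  0 <= \sum_(k : mbox L N) `|F (mbox_val k)| * 2^-1 ^+ (n * mdeg (mbox_val k)).
Proof. by apply: sumr_ge0 => k _; rewrite mulr_ge0. Qed.

Lemma norm_le_ge0 n B F : norm_le n B F -> 0 <= B.
Proof. by move/(_ 0%N); apply: le_trans; exact: norm_sum_ge0. Qed.

Lemma norm_leD n B B' F G :
  norm_le n B F -> norm_le n B' G -> norm_le n (B + B') (F + G).
Proof.
move=> FB GB N; apply: le_trans (lerD (FB N) (GB N)); rewrite -big_split /=.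
by apply: ler_sum => m _; rewrite -mulrDl ler_wpM2r // ler_normD.
Qed.

(** Boxes are closed under decomposition of their members: a product is
    summed over all pairs in the box whose sum stays in the box. *)
Lemma box_sumM (g : mindex L -> C) F G N :
  \sum_(k : mbox L N) (F * G) (mbox_val k) * g (mbox_val k) =
  \sum_(k : mbox L N) \sum_(l : mbox L N)
    (F (mbox_val k) * G (mbox_val l) * g (mbox_val k + mbox_val l))
    *+ (mbox_val k + mbox_val l \in box_fset L N).
Proof.
transitivity (\sum_(m : mbox L N) \sum_(k : mbox L N) \sum_(l : mbox L N)
   (F (mbox_val k) * G (mbox_val l) * g (mbox_val k + mbox_val l))
    *+ (mbox_val k + mbox_val l == mbox_val m)).
  apply: eq_bigr => m _; rewrite (fpsM_box _ _ (@mbox_val_le _ _ m)).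
  rewrite mulr_suml; apply: eq_bigr => k _; rewrite mulr_suml.
  by apply: eq_bigr => l _; rewrite mulrnAl; case: eqP => // ->.
rewrite exchange_big; apply: eq_bigr => k _; rewrite exchange_big /=.
apply: eq_bigr => l _; have [/box_fsetP/mboxP[m0 m0E]|out] := boolP (_ \in _).
  rewrite (bigD1 m0) //= m0E eqxx big1 ?addr0 // => m mm0.
  by rewrite -m0E (inj_eq (@mbox_val_inj _ _)) eq_sym (negbTE mm0).
rewrite big1 // => m _; case: eqP => // e.
by case/box_fsetP: out => i; rewrite e mbox_val_le.
Qed.

(** By the triangle inequality it suffices to bound the product of the series of
    absolute values, whose box sum omits some of the pairs. *)
Lemma norm_leM n B B' F G :
  norm_le n B F -> norm_le n B' G -> norm_le n (B * B') (F * G).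
Proof.
move=> FB GB N; pose nF : fps L C := fun m => `|F m|.
pose nG : fps L C := fun m => `|G m|.
apply: (@le_trans _ _ (\sum_(k : mbox L N)
    (nF * nG) (mbox_val k) * 2^-1 ^+ (n * mdeg (mbox_val k)))).
  apply: ler_sum => m _; rewrite ler_wpM2r //.
  rewrite !(fpsM_box _ _ (@mbox_val_le _ _ m)).
  apply: le_trans (ler_norm_sum _ _ _) _; apply: ler_sum => k _.
  apply: le_trans (ler_norm_sum _ _ _) _; apply: ler_sum => l _.
  by rewrite normrMn normrM.
rewrite (box_sumM (fun m => 2^-1 ^+ (n * mdeg m))).
apply: le_trans (ler_pM (norm_sum_ge0 _ _ _) (norm_sum_ge0 _ _ _) (FB N) (GB N)).
rewrite mulr_suml; apply: ler_sum => k _; rewrite mulr_sumr; apply: ler_sum => l _.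
rewrite mdegD mulnDr exprD mulrACA; case: (_ \in _) => //.
by rewrite mulr0n !mulr_ge0.
Qed.

(** The pairs missing from the box sum of the product have total degree above
    [N], and halving the radius gains a factor [2^-1] per degree. *)
Lemma box_sumM_dist n B B' F G t N :
  norm_le n B F -> norm_le n B' G -> in_polydisc n.+1 t ->
  `|box_sum F t N * box_sum G t N - box_sum (F * G) t N| <= B * B' * 2^-1 ^+ N.
Proof.
move=> FB GB tn; rewrite /box_sum (box_sumM (monomial t)).
rewrite mulr_suml -sumrB.
apply: (@le_trans _ _ ((\sum_(k : mbox L N) `|F (mbox_val k)| * 2^-1 ^+ (n * mdeg (mbox_val k)))
  * (\sum_(k : mbox L N) `|G (mbox_val k)| * 2^-1 ^+ (n * mdeg (mbox_val k)))
  * 2^-1 ^+ N)); last first.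
  by rewrite ler_wpM2r // ler_pM ?norm_sum_ge0 ?FB ?GB.
apply: le_trans (ler_norm_sum _ _ _) _; rewrite !mulr_suml; apply: ler_sum => k _.
rewrite mulr_sumr -sumrB; apply: le_trans (ler_norm_sum _ _ _) _.
rewrite mulr_sumr mulr_suml; apply: ler_sum => l _.
rewrite monomialD mulrACA; case: (boolP (_ \in _)) => [_|/notin_box_fset kl].
  by rewrite mulr1n subrr normr0 !mulr_ge0.
rewrite mulr0n subr0 !normrM [leRHS](_ : _ = `|F (mbox_val k)| * `|G (mbox_val l)| *
    (2^-1 ^+ (n * mdeg (mbox_val k + mbox_val l)) * 2^-1 ^+ N)); last first.
  by rewrite mdegD mulnDr exprD; ring.
rewrite ler_wpM2l ?mulr_ge0 // -normrM -monomialD.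
apply: le_trans (monomial_le _ tn) _; rewrite -exprD hle //.
by rewrite mulSnr leq_add2l ltnW.
Qed.


Lemma box_sumD F G t N : box_sum (F + G) t N = box_sum F t N + box_sum G t N.
Proof. by rewrite -big_split; apply: eq_bigr => k _; rewrite /= -mulrDl. Qed.

Lemma box_sumN F t N : box_sum (- F) t N = - box_sum F t N.
Proof. by rewrite -sumrN; apply: eq_bigr => k _; rewrite -mulNr. Qed.

Definition fps_const (a : C) : fps L C := fun m => if m == 0 then a else 0.

Lemma big_mbox0 (g : mindex L -> C) N : (forall m, m != 0 -> g m = 0) ->
  \sum_(k : mbox L N) g (mbox_val k) = g 0.
Proof.
move=> g0; have [k0 k00] : exists k : mbox L N, mbox_val k = 0.
  by apply: mboxP => i; rewrite ffunE.
rewrite (bigD1 k0) //= k00 big1 ?addr0 // => k kk0.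
by rewrite g0 // -k00 (inj_eq (@mbox_val_inj _ _)).
Qed.

Lemma box_sum_const a t N : box_sum (fps_const a) t N = a.
Proof.
rewrite /box_sum (big_mbox0 (g := fun m => fps_const a m * monomial t m)).
  by rewrite /fps_const eqxx /monomial big1 ?mulr1 // => l _; rewrite ffunE.
by move=> m m0; rewrite /fps_const (negbTE m0) mul0r.
Qed.

Lemma norm_le_const n a : norm_le n `|a| (fps_const a).
Proof.
move=> N; rewrite (big_mbox0 (g := fun m => `|fps_const a m| * 2^-1 ^+ (n * mdeg m))).
  rewrite /fps_const eqxx /mdeg big1 ?muln0 ?mulr1 // => l _; by rewrite ffunE.
by move=> m m0; rewrite /fps_const (negbTE m0) normr0 mul0r.
Qed.

Lemma fps_const1 : fps_const 1 = 1.
Proof. by apply/funext => m; rewrite fps1 /fps_const; case: (m == 0). Qed.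

Lemma represents_const a : represents (fps_const a) (fun=> a).
Proof.
exists 0%N, `|a|; split=> [|t _]; first exact: norm_le_const.
have -> : box_sum (fps_const a) t = fun=> a.
  by apply/funext => N; rewrite box_sum_const.
exact: cvg_cst.
Qed.

Lemma represents0 : represents 0 (fun=> 0).
Proof.
have -> : (0 : fps L C) = fps_const 0 by apply/funext => m; rewrite /fps_const; case: ifP.
exact: represents_const.
Qed.

Lemma represents1 : represents 1 (fun=> 1).
Proof. by rewrite -fps_const1; exact: represents_const. Qed.

Lemma representsD F G f g : represents F f -> represents G g ->
  represents (F + G) (fun t => f t + g t).
Proof.
move=> [n [B [FB Ff]]] [n' [B' [GB Gg]]]; exists (maxn n n'), (B + B'); split.
  by apply: norm_leD; [apply: norm_leS FB | apply: norm_leS GB];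
     rewrite ?leq_maxl ?leq_maxr.
move=> t tn; have -> : box_sum (F + G) t = box_sum F t + box_sum G t.
  by apply/funext => N; rewrite box_sumD.
by apply: cvgD; [apply: Ff | apply: Gg]; apply: in_polydiscS tn;
   rewrite ?leq_maxl ?leq_maxr.
Qed.

Lemma representsN F f : represents F f -> represents (- F) (fun t => - f t).
Proof.
move=> [n [B [FB Ff]]]; exists n, B; split.
  by move=> N; under eq_bigr do rewrite fpsN normrN; exact: FB.
move=> t tn; have -> : box_sum (- F) t = - box_sum F t.
  by apply/funext => N; rewrite box_sumN.
by apply: cvgN; exact: Ff.
Qed.

Lemma representsM F G f g : represents F f -> represents G g ->
  represents (F * G) (fun t => f t * g t).
Proof.
move=> [n [B [FB Ff]]] [n' [B' [GB Gg]]].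
have {}FB : norm_le (maxn n n') B F by apply: norm_leS FB; exact: leq_maxl.
have {}GB : norm_le (maxn n n') B' G by apply: norm_leS GB; exact: leq_maxr.
exists (maxn n n').+1, (B * B'); split.
  by apply: (norm_leS (leqnSn _)); exact: norm_leM.
move=> t tn.
have FG : (fun N => box_sum F t N * box_sum G t N) @ \oo --> f t * g t.
  apply: cvgM; [apply: Ff | apply: Gg]; apply: in_polydiscS tn;
   by rewrite leqW // ?leq_maxl ?leq_maxr.
have d0 : (fun N => box_sum F t N * box_sum G t N - box_sum (F * G) t N) @ \oo
    --> (0 : C).
  apply: (@cvg_half_bound _ _ (B * B')) => N; rewrite subr0; exact: box_sumM_dist.
have -> : box_sum (F * G) t = (fun N => box_sum F t N * box_sum G t N -
    (box_sum F t N * box_sum G t N - box_sum (F * G) t N)).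
  by apply/funext => N; rewrite subKr.
by rewrite -[f t * g t]subr0; exact: (cvgB FG d0).
Qed.

(** Every monomial of positive degree gains the factor [2^-k]. *)
Lemma norm_le_shrink n k B F : F 0 = 0 -> norm_le n B F ->
  norm_le (n + k) (B * 2^-1 ^+ k) F.
Proof.
move=> F0 FB N; apply: le_trans (ler_wpM2r (h01 k) (FB N)).
rewrite mulr_suml; apply: ler_sum => m _.
have [m0|m0] := posnP (mdeg (mbox_val m)).
  by rewrite (mdeg_eq0 m0) F0 normr0 !mul0r.
by rewrite -mulrA ler_wpM2l // -exprD hle // mulnDl leq_add2l leq_pmulr.
Qed.

Lemma norm_leX n F i : norm_le n 2^-1 F -> norm_le n (2^-1 ^+ i) (F ^+ i).
Proof.
move=> FB; elim: i => [|i IH]; last by rewrite !exprS; exact: norm_leM.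
by rewrite !expr0 -fps_const1 -{1}(normr1 C); exact: norm_le_const.
Qed.

Lemma norm_le_geom n F : F 0 = 0 -> norm_le n 2^-1 F -> norm_le n 2 (fps_geom F).
Proof.
move=> F0 FB.
have part W : norm_le n (2 - 2 * 2^-1 ^+ W) (\sum_(i < W) F ^+ i).
  elim: W => [|W IH].
    rewrite expr0 mulr1 subrr big_ord0 => N; rewrite big1 // => k _.
    by rewrite normr0 mul0r.
  rewrite big_ord_recr /=.
  have -> : 2 - 2 * 2^-1 ^+ W.+1 = 2 - 2 * 2^-1 ^+ W + 2^-1 ^+ W :> C.
    by rewrite exprS mulrA divff ?mul1r; [ring | rewrite pnatr_eq0].
  by apply: norm_leD => //; exact: norm_leX.
move=> N; apply: (@le_trans _ _ (2 - 2 * 2^-1 ^+ (L * N).+1)); last first.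
  by rewrite gerBl mulr_ge0.
apply: le_trans (part (L * N).+1 N); apply: ler_sum => k _.
rewrite (fps_geom_upto (N := (L * N)%N)) //.
apply: leq_trans (_ : (\sum_(i < L) N <= _)%N); last by rewrite sum_nat_const card_ord.
by apply: leq_sum => i _; exact: mbox_val_le.
Qed.

(** On a small enough polydisc, [1 - F / F(0)] has norm at most [1/2], and the
    geometric series converges. *)
Lemma norm_le_inv n B F : F 0 != 0 -> norm_le n B F ->
  exists k D, norm_le k D F^-1.
Proof.
move=> F0 FB; pose a := (F 0)^-1; pose u := 1 - fps_const a * F.
have u0 : u 0 = 0.
  by rewrite /u fpsD fpsN fpsM0 /fps_const fps1 eqxx mulVf // subrr.
have FV : F^-1 = fps_geom u * fps_const a.
  have uF : F \is a GRing.unit by rewrite fps_unitP.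
  apply: (mulIr uF); rewrite mulVr // -mulrA mulrC; apply/esym.
  by have := fps_geomE u0; rewrite /u subKr.
have [D uD] : exists D, norm_le n D u.
  exists (1 + `|a| * B); apply: norm_leD; first by
    rewrite -fps_const1 -{1}(normr1 C); exact: norm_le_const.
  move=> N; under eq_bigr do rewrite fpsN normrN.
  by apply: norm_leM => //; exact: norm_le_const.
have D0 := norm_le_ge0 uD.
have [k kD] : exists k, 2^-1 ^+ k < 2^-1 / (D + 1).
  by apply: half_expn_lt; rewrite divr_gt0 ?invr_gt0 // ltr_wpDl.
exists (n + k)%N, (2 * `|a|); rewrite FV; apply: norm_leM; last exact: norm_le_const.
apply: norm_le_geom => // N; apply: le_trans (norm_le_shrink k u0 uD N) _.
apply: (@le_trans _ _ ((D + 1) * 2^-1 ^+ k)); first by rewrite ler_wpM2r // lerDl.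
by rewrite mulrC -ler_pdivlMr ?ltr_wpDl // ltW.
Qed.

Lemma box_sum_bound n B F t N : norm_le n B F -> in_polydisc n t ->
  `|box_sum F t N| <= B.
Proof.
move=> FB tn; apply: le_trans (FB N); apply: le_trans (ler_norm_sum _ _ _) _.
by apply: ler_sum => k _; rewrite normrM ler_wpM2l // monomial_le.
Qed.

(** The box sums of [F] and [F^-1] have products tending to [1] while those of
    [F^-1] stay bounded, so [f] cannot vanish. *)
Lemma represents_inv F f : F 0 != 0 -> represents F f ->
  (exists n, forall t, in_polydisc n t -> f t != 0) /\
  represents F^-1 (fun t => (f t)^-1).
Proof.
move=> F0 [n [B [FB Ff]]]; have [k [D FD]] := norm_le_inv F0 FB.
have {}FB : norm_le (maxn n k) B F by apply: norm_leS FB; exact: leq_maxl.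
have {}FD : norm_le (maxn n k) D F^-1 by apply: norm_leS FD; exact: leq_maxr.
have uF : F \is a GRing.unit by rewrite fps_unitP.
have D0 := norm_le_ge0 FD.
have prod1 t : in_polydisc (maxn n k).+1 t ->
    box_sum F t \* box_sum F^-1 t @ \oo --> (1 : C).
  move=> tn; apply: (@cvg_half_bound _ _ (B * D)) => N.
  have := box_sumM_dist N FB FD tn; rewrite divrr // -fps_const1.
  by rewrite box_sum_const.
have F_cvg t : in_polydisc (maxn n k).+1 t -> box_sum F t @ \oo --> f t.
  by move=> tn; apply: Ff; apply: in_polydiscS tn; rewrite leqW // leq_maxl.
have f_neq0 t : in_polydisc (maxn n k).+1 t -> f t != 0.
  move=> tn; apply/eqP => ft0; move: (F_cvg _ tn) (prod1 _ tn); rewrite ft0.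
  move=> /cvgrPdist_lt/(_ (2^-1 / (D + 1))) [|N1 _ F1].
    by rewrite divr_gt0 ?invr_gt0 // ltr_wpDl.
  move=> /cvgrPdist_lt/(_ 2^-1) [|N2 _ F2]; first by rewrite invr_gt0.
  pose N := maxn N1 N2.
  have {}F1 := F1 N (leq_maxl _ _); have {}F2 := F2 N (leq_maxr _ _).
  have {}FD : `|box_sum F^-1 t N| <= D.
    by apply: box_sum_bound FD _; apply: in_polydiscS tn.
  have : 1 < 2^-1 + 2^-1 :> C.
    rewrite -[ltLHS]normr1 -[in ltLHS](subrK (box_sum F t N * box_sum F^-1 t N) 1).
    apply: le_lt_trans (ler_normD _ _) _; apply: ltrD; first exact: F2.
    rewrite normrM; apply: le_lt_trans (_ : `|box_sum F t N| * (D + 1) < _).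
      by rewrite ler_wpM2l // (le_trans FD) // lerDl.
    by rewrite -ltr_pdivlMr ?ltr_wpDl //; move: F1; rewrite sub0r normrN.
  by rewrite -[2^-1]mul1r -splitr ltxx.
split; first by exists (maxn n k).+1.
exists (maxn n k).+1, D; split; first exact: norm_leS (leqnSn _) FD.
move=> t tn; have ft := f_neq0 _ tn.
have FN : \forall N \near \oo, box_sum F t N != 0.
  exact: (cvgr_neq0 (f t) (F_cvg _ tn) ft).
have : (fun N => (box_sum F t N)^-1 * (box_sum F t \* box_sum F^-1 t) N) @ \oo
    --> (f t)^-1 * 1.
  by apply: cvgM; [apply: cvgV => //; exact: F_cvg | exact: prod1].
rewrite mulr1; apply: cvg_trans; apply: near_eq_cvg.
by apply: filterS FN => N FN; rewrite /= mulKf.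
Qed.

End Series.

(** One statement for a relation between elements of a ring and functions, so as
    to apply both to series with the function they represent and to
    differentiability alone. *)
Lemma determinant_closed (A B : comPzRingType) (X : Type)
    (P : A -> (X -> B) -> Prop) :
  P 0 (fun=> 0) -> P 1 (fun=> 1) ->
  (forall a b f g, P a f -> P b g -> P (a + b) (fun x => f x + g x)) ->
  (forall a f, P a f -> P (- a) (fun x => - f x)) ->
  (forall a b f g, P a f -> P b g -> P (a * b) (fun x => f x * g x)) ->
  forall n (M : 'M[A]_n) (N : X -> 'M[B]_n),
  (forall i j, P (M i j) (fun x => N x i j)) -> P (\det M) (fun x => \det (N x)).
Proof.
move=> P0 P1 PD PN PM n M N MN.
have Pext a f g : P a f -> f =1 g -> P a g by move=> Pf /funext <-.
have Psign (b : bool) : P ((-1) ^+ b) (fun=> (-1) ^+ b).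
  by case: b; rewrite ?expr0 ?expr1 //; exact: PN.
have Psum (I : Type) (s : seq I) (F : I -> A) (G : I -> X -> B) :
    (forall i, P (F i) (G i)) -> P (\sum_(i <- s) F i) (fun x => \sum_(i <- s) G i x).
  move=> FG; elim: s => [|i s IH].
    by rewrite big_nil; apply: Pext P0 _ => x; rewrite big_nil.
  by rewrite big_cons; apply: Pext (PD _ _ _ _ (FG i) IH) _ => x; rewrite big_cons.
have Pprod (I : Type) (s : seq I) (F : I -> A) (G : I -> X -> B) :
    (forall i, P (F i) (G i)) -> P (\prod_(i <- s) F i) (fun x => \prod_(i <- s) G i x).
  move=> FG; elim: s => [|i s IH].
    by rewrite big_nil; apply: Pext P1 _ => x; rewrite big_nil.
  by rewrite big_cons; apply: Pext (PM _ _ _ _ (FG i) IH) _ => x; rewrite big_cons.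
apply: Psum => s; apply: (PM); last by apply: Pprod => i; exact: MN.
exact: Psign.
Qed.

#[local] Existing Instance summability.totally_filter.

Section Sums.
Variables (R : realType) (L : nat).
Local Notation C := R[i].
Local Notation T := 'rV[C]_L.
Implicit Types (F G : fps L C) (t : T) (m : mindex L).

Lemma partial_sumE (x : mindex L -> C) A :
  summability.partial_sum x A = \sum_(m <- A) x m.
Proof. by rewrite /summability.partial_sum big_seq_fsetE. Qed.

Lemma box_fset_totally : box_fset L @ \oo --> summability.totally.
Proof.
move=> P [A _ AP]; have [N AN] := box_fset_sub A.
exists N => // k /= Nk; apply: AP => /=; apply: fsubset_trans AN _.
by apply/fsubsetP => m /box_fsetP mN; apply/box_fsetP => i; exact: leq_trans (mN i) Nk.
Qed.

Lemma fps_sums_to_box F t z : fps_sums_to F t z -> box_sum F t @ \oo --> z.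
Proof.
move=> Fz; have -> : box_sum F t =
    summability.partial_sum (fun m => F m * monomial t m) \o box_fset L.
  by apply/funext => N; rewrite /= partial_sumE sum_box_fset.
exact: cvg_comp box_fset_totally Fz.
Qed.

Lemma sum_fset_le n B F (A : {fset mindex L}) : norm_le n B F ->
  \sum_(m <- A) `|F m| * 2^-1 ^+ (n * mdeg m) <= B.
Proof.
move=> FB; have [N AN] := box_fset_sub A.
apply: le_trans (FB N); rewrite -(sum_box_fset N (fun m => `|F m| * 2^-1 ^+ (n * mdeg m))).
rewrite (sum_fset_split _ AN) lerDl; apply: sumr_ge0 => m _.
by rewrite mulr_ge0 // exprn_ge0 // invr_ge0.
Qed.

(** A finite set containing the box of size [N] misses only terms of degree above
    [N], which are small on half the polydisc. *)
Lemma norm_le_sums_to n B F t z : norm_le n B F -> in_polydisc n.+1 t ->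
  box_sum F t @ \oo --> z -> fps_sums_to F t z.
Proof.
move=> FB tn /cvgrPdist_lt Fz; apply/cvgrPdist_lt => e e0.
have B0 := norm_le_ge0 FB.
have [N1 _ F1] := Fz (e / 2) (divr_gt0 e0 (ltr0n _ 2)).
have [N2 F2] : exists N, 2^-1 ^+ N < e / 2 / (B + 1).
  by apply: half_expn_lt; rewrite !divr_gt0 // ltr_wpDl.
pose N := maxn N1 N2; exists (box_fset L N) => // A /= NA.
rewrite partial_sumE (sum_fset_split _ NA) sum_box_fset opprD addrA.
apply: le_lt_trans (ler_normB _ _) _; rewrite [ltRHS]splitr.
apply: ltr_leD; first exact: (F1 N (leq_maxl _ _)).
apply: (@le_trans _ _ (B * 2^-1 ^+ N)); last first.
  apply: (@le_trans _ _ ((B + 1) * 2^-1 ^+ N2)).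
    rewrite ler_pM // ?exprn_ge0 ?invr_ge0 // ?lerDl //.
    by rewrite ler_wiXn2l ?invr_ge0 ?invf_le1 ?ler1n ?leq_maxr.
  by rewrite mulrC -ler_pdivlMr ?ltr_wpDl // ltW.
pose A' := [fset m in A | m \notin box_fset L N]%fset.
apply: (@le_trans _ _ (\sum_(m <- A') `|F m| * 2^-1 ^+ (n * mdeg m) * 2^-1 ^+ N)).
  apply: le_trans (ler_norm_sum _ _ _) _.
  rewrite big_seq [leRHS]big_seq; apply: ler_sum => m.
  rewrite mem_fset_diff => /andP[_ /notin_box_fset Nm].
  rewrite normrM -mulrA ler_wpM2l //; apply: le_trans (monomial_le _ tn) _.
  rewrite -exprD ler_wiXn2l ?invr_ge0 ?invf_le1 ?ler1n //.
  by rewrite mulSnr leq_add2l ltnW.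
rewrite -mulr_suml ler_wpM2r ?exprn_ge0 ?invr_ge0 //; exact: sum_fset_le.
Qed.

Lemma represents_sums_to F f : represents F f ->
  exists n, forall t, in_polydisc n t -> fps_sums_to F t (f t).
Proof.
move=> [n [B [FB Ff]]]; exists n.+1 => t tn; apply: (norm_le_sums_to FB tn).
by apply: Ff; apply: in_polydiscS tn.
Qed.

(** Convergence along the finite sets bounds the terms, so that the series
    converges absolutely on the polydisc of half the radius. *)
Lemma sums_to_norm_le n F z :
  fps_sums_to F (const_mx (2^-1 ^+ n)) z -> exists B, norm_le n.+1 B F.
Proof.
move=> /cvgrPdist_lt/(_ 1 ltr01) [A _ FA].
pose w m := F m * monomial (const_mx (2^-1 ^+ n) : T) m.
have wE m : `|w m| = `|F m| * 2^-1 ^+ (n * mdeg m).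
  rewrite /w normrM /monomial normr_prod /mdeg big_distrr -prodrXr /=; congr (_ * _).
  by apply: eq_bigr => i _; rewrite mxE -exprM ger0_norm //.
pose B := 2 + \sum_(m <- A) `|w m|.
have wB m : `|w m| <= B.
  have [mA|mA] := boolP (m \in A).
    rewrite /B (big_fsetD1 m mA) /= addrCA lerDl addr_ge0 //.
    by apply: sumr_ge0 => i _.
  have := FA A (fsubset_refl A); rewrite /= partial_sumE => e1.
  have := FA (m |` A)%fset (fsubsetUr _ _); rewrite /= partial_sumE => e2.
  rewrite big_fsetU1 //= in e2.
  apply: (@le_trans _ _ 2); last by rewrite lerDl sumr_ge0.
  rewrite -/(w m) in e2; set S := \sum_(_ <- _) _ in e1 e2.
  have -> : w m = (z - S) - (z - (w m + S)) by ring.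
  apply: le_trans (ler_normB _ _) _; apply: ltW.
  by rewrite -[ltRHS]/(1 + 1) ltrD.
exists (B * 2 ^+ L) => N.
apply: (@le_trans _ _ (B * \sum_(k : mbox L N) \prod_l 2^-1 ^+ (k l))).
  rewrite mulr_sumr; apply: ler_sum => k _.
  rewrite mulSnr exprD mulrA -wE /mdeg -prodrXr.
  under eq_bigr do rewrite ffunE.
  by rewrite ler_wpM2r // prodr_ge0 // => i _; rewrite exprn_ge0 ?invr_ge0.
rewrite ler_wpM2l //; first exact: le_trans (wB 0).
rewrite -(bigA_distr_bigA (fun (_ : 'I_L) (j : 'I_N.+1) => 2^-1 ^+ j)).
rewrite prodr_const card_ord lerXn2r ?nnegrE //.
  by apply: sumr_ge0 => j _; rewrite exprn_ge0 ?invr_ge0.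
have -> : \sum_(j < N.+1) 2^-1 ^+ j = 2 - 2 * 2^-1 ^+ N.+1 :> C.
  elim: N => [|N' IH].
    by rewrite big_ord1 expr0 expr1 divff ?pnatr_eq0 //; ring.
  rewrite big_ord_recr /= IH [in RHS]exprS mulrA divff ?pnatr_eq0 // mul1r.
  by set y := 2^-1 ^+ N'.+1; ring.
by rewrite gerBl mulr_ge0 // exprn_ge0 ?invr_ge0.
Qed.

Lemma near_polydisc (P : T -> Prop) : (\forall t \near (0 : T), P t) ->
  exists n, forall t, in_polydisc n t -> P t.
Proof.
move=> /nbhs_ballP[e /= e0 eP]; have [n ne] := half_expn_lt e0.
exists n => t tn; apply: eP; split=> // i j; rewrite (ord1 i) -ball_normE /= mxE sub0r normrN.
exact: le_lt_trans (tn j) ne.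
Qed.

Lemma polydisc_near n : \forall t \near (0 : T), in_polydisc n t.
Proof.
have h0 : 0 < 2^-1 ^+ n :> C by rewrite exprn_gt0 // invr_gt0.
apply/nbhs_ballP; exists (2^-1 ^+ n) => //= t te l.
by have [_ /(_ 0 l)] := te; rewrite -ball_normE /= mxE sub0r normrN => /ltW.
Qed.

Lemma near_represents F (f : T -> C) :
  (\forall t \near (0 : T), fps_sums_to F t (f t)) -> represents F f.
Proof.
move=> /near_polydisc[n Ff].
have [|B FB] := @sums_to_norm_le n F (f (const_mx (2^-1 ^+ n))).
  apply: Ff => l; rewrite mxE ger0_norm // exprn_ge0 // invr_ge0 //.
exists n.+1, B; split=> // t tn; apply: fps_sums_to_box; apply: Ff.
exact: in_polydiscS tn.
Qed.

Lemma represents_tau (A : smx (fps L C)) (B : T -> smx C) :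
  (forall i j, represents (A i j) (fun t => B t i j)) ->
  forall N, represents (tau A N) (fun t => tau (B t) N).
Proof.
move=> AB N; apply: (determinant_closed (P := @represents R L)).
- exact: represents0.
- exact: represents1.
- exact: representsD.
- exact: representsN.
- exact: representsM.
- move=> i j; rewrite mxE; under eq_fun do rewrite mxE; exact: AB.
Qed.

End Sums.

(** * Gauss-Borel factorization with parameters *)

Section GaussBorelFactors.
Variables (K : fieldType) (A : smx K).

Lemma gb_upper_diag i : gb_upper A i i = tau A i / tau A i.+1.
Proof.
rewrite /gb_upper leqnn.
have -> : inord i = ord_max :> 'I_i.+1 by apply: val_inj; rewrite /= inordK.
by rewrite adj_last.
Qed.

Lemma gb_upper_orth r s : tau A s.+1 != 0 -> (r <= s)%N ->
  \sum_(k < s.+1) A r k * gb_upper A k s = (r == s)%:R.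
Proof.
move=> us rs; transitivity
    ((leading s.+1 A *m \adj (leading s.+1 A)) (inord r) ord_max / tau A s.+1).
  rewrite mxE mulr_suml; apply: eq_bigr => k _.
  by rewrite /gb_upper -ltnS ltn_ord inord_val !mxE inordK // mulrA.
rewrite mul_mx_adj mxE -/(tau A s.+1).
have -> : (inord r == ord_max :> 'I_s.+1) = (r == s) by rewrite -val_eqE /= inordK.
by case: (r == s); rewrite ?mulr1n ?divff // mulr0n mul0r.
Qed.

Lemma gb_lower_above i j : (i < j)%N -> gb_lower A i j = 0.
Proof. by rewrite /gb_lower ltnNge; case: leqP. Qed.

Lemma gb_upper_below i j : (j < i)%N -> gb_upper A i j = 0.
Proof. by rewrite /gb_upper ltnNge; case: leqP. Qed.

Variable N : nat.
Hypothesis tauN : forall n, (n <= N)%N -> tau A n != 0.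

(** The product is upper triangular as [(S A) U] and unit lower triangular as
    [S (A U)]. *)
Lemma gb_mulmx :
  leading N (gb_lower A) *m leading N A *m leading N (gb_upper A) = 1%:M.
Proof.
have SA (i s : 'I_N) : (s < i)%N -> (leading N (gb_lower A) *m leading N A) i s = 0.
  move=> si; transitivity (colform A s (orthopoly A i)).
    rewrite (colform_wide A s (size_poly _ _)) mxE.
    rewrite (big_ord_widen _ (fun r => (orthopoly A i)`_r * A r s) (ltn_ord i)).
    rewrite [RHS]big_mkcond; apply: eq_bigr => j _; rewrite !mxE /=.
    case: ltnP => ij; first by rewrite coef_poly ij.
    by rewrite gb_lower_above ?mul0r.
  have ui : tau A i \is a GRing.unit by rewrite unitfE tauN // ltnW.
  by rewrite colform_orthopoly ?(ltnW si) // (ltn_eqF si).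
have AU (r s : 'I_N) : (r <= s)%N ->
    (leading N A *m leading N (gb_upper A)) r s = (r == s)%:R.
  move=> rs; have := gb_upper_orth (tauN (ltn_ord s)) rs.
  rewrite -val_eqE => <-; rewrite mxE.
  rewrite (big_ord_widen _ (fun k => A r k * gb_upper A k s) (ltn_ord s)).
  rewrite [RHS]big_mkcond; apply: eq_bigr => j _; rewrite !mxE /=.
  by case: ltnP => // sj; rewrite gb_upper_below ?mulr0.
apply/matrixP => i j; rewrite [RHS]mxE; case: (ltnP j i) => ij.
  rewrite mxE big1 => [|k _].
    by rewrite (_ : (i == j) = false) // -val_eqE gtn_eqF.
  case: (ltnP k i) => ki; first by rewrite SA ?mul0r.
  by rewrite [leading N (gb_upper A) k j]mxE gb_upper_below ?mulr0 // (leq_trans ij).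
rewrite -mulmxA mxE; transitivity (\sum_(k < N) gb_lower A i k * (k == j)%:R).
  apply: eq_bigr => k _; rewrite [leading N (gb_lower A) i k]mxE.
  case: (leqP k i) => ki; last by rewrite gb_lower_above ?mul0r.
  by rewrite AU // (leq_trans ki).
rewrite (bigD1 j) //= eqxx mulr1 big1 ?addr0 => [|k /negbTE ->]; last by rewrite mulr0.
have [->|ne] := eqVneq i j.
  by rewrite gb_lower_diag // unitfE tauN // ltnW.
by rewrite gb_lower_above // ltn_neqAle ij val_eqE ne.
Qed.

Lemma gauss_borel_factors : gauss_borel N A (gb_lower A) (gb_upper A).
Proof.
have SAU := gb_mulmx; split.
- by move=> i iN; rewrite gb_lower_diag // unitfE tauN // ltnW.
- by move=> i j /andP[ij _]; exact: gb_lower_above.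
- by move=> i iN; rewrite gb_upper_diag mulf_neq0 ?invr_eq0 ?tauN // ltnW.
- by move=> i j /andP[ij _]; exact: gb_upper_below.
- have [uSA uU] := mulmx1_unit SAU.
  have uS : leading N (gb_lower A) \in unitmx.
    by move: uSA; rewrite unitmx_mul => /andP[].
  by rewrite -[invmx (leading N (gb_upper A))]mul1mx -SAU mulmxK // mulKmx.
Qed.

End GaussBorelFactors.

(** The last row of the inverse of the upper triangular factor is supported on
    the diagonal, so the entry is [U_(h-p,h-p) / U_(h,h)]. *)
Lemma recurrence_coef_gb (K : fieldType) (A : smx K) (p h : nat) : (p <= h)%N ->
  (forall n, (n <= h.+1)%N -> tau A n != 0) ->
  recurrence_coef p (gb_upper A) h = tau_ratio p A h.
Proof.
move=> ph tauN; rewrite /recurrence_coef; set U := leading h.+1 (gb_upper A).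
have uU : U \in unitmx by have [] := mulmx1_unit (gb_mulmx tauN).
have Uhh : U ord_max ord_max != 0.
  by rewrite mxE gb_upper_diag mulf_neq0 ?invr_eq0 ?tauN.
have invU j : (invmx U) ord_max j = (U ord_max ord_max)^-1 * (ord_max == j)%:R.
  apply: (mulfI Uhh); rewrite mulVKf //.
  have := congr1 (fun B : 'M[K]_h.+1 => B ord_max j) (mulmxV uU).
  rewrite !mxE (bigD1 ord_max) //= big1 ?addr0 => [<-|k kh].
    by rewrite mxE.
  rewrite mxE gb_upper_below ?mul0r // ltn_neqAle -ltnS ltn_ord andbT.
  by move: kh; rewrite -val_eqE.
set Sh := leading h.+1 _.
have row_shift k : (invmx U *m Sh) ord_max k =
    (U ord_max ord_max)^-1 * (h == k + p)%N%:R.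
  rewrite mxE (bigD1 ord_max) //= invU eqxx mulr1 big1 ?addr0 ?mxE // => j jh.
  by rewrite invU eq_sym (negbTE jh) mulr0 mul0r.
have hp : (h - p < h.+1)%N by rewrite ltnS leq_subr.
rewrite mxE (bigD1 (inord (h - p))) //= big1 ?addr0 => [|k kh]; last first.
  rewrite row_shift (_ : (h == k + p)%N = false) ?mulr0 ?mul0r //.
  apply: contra_neqF kh => /eqP hk; apply: val_inj.
  by rewrite /= inordK // [in RHS]hk addnK.
rewrite row_shift inordK // subnK // eqxx mulr1 !mxE inordK // !gb_upper_diag.
rewrite /tau_ratio invfM invrK; have t2 := tauN _ (leqnn h.+1); field.
by rewrite /= (tauN h) ?leqnSn // tauN.
Qed.

Section Differentiability.
Variables (R : realType) (L : nat).
Local Notation C := R[i].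
Local Notation T := 'rV[C]_L.
Variables (A : T -> smx C) (t0 : T).
Hypothesis dA : forall i j, differentiable (fun t => A t i j) t0.

Lemma differentiable_det n (M : T -> 'M[C]_n) :
  (forall i j, differentiable (fun t => M t i j) t0) ->
  differentiable (fun t => \det (M t)) t0.
Proof.
move=> dM; pose P (_ : C) (f : T -> C) : Prop := differentiable f t0.
apply: (@determinant_closed _ _ _ P _ _ _ _ _ n (M t0)); rewrite /P.
- exact: differentiable_cst.
- exact: differentiable_cst.
- by move=> _ _ f g; exact: differentiableD.
- by move=> _ f; exact: differentiableN.
- by move=> _ _ f g; exact: differentiableM.
- exact: dM.
Qed.

Lemma differentiable_tau N : differentiable (fun t => tau (A t) N) t0.
Proof.
apply: differentiable_det => i j.
by rewrite (_ : (fun _ => _) = (fun t => A t i j)) //; apply/funext => t; rewrite mxE.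
Qed.

Lemma differentiable_div (f g : T -> C) : differentiable f t0 ->
  differentiable g t0 -> g t0 != 0 -> differentiable (fun t => f t / g t) t0.
Proof.
by move=> df dg g0; exact: (differentiableM df (differentiableV dg g0)).
Qed.

Lemma differentiable_adj n (i j : 'I_n) :
  differentiable (fun t => (\adj (leading n (A t))) i j) t0.
Proof.
rewrite (_ : (fun _ => _) = (fun t => (-1) ^+ (j + i) *
    \det (row' j (col' i (leading n (A t)))))); last first.
  by apply/funext => t; rewrite mxE.
apply: differentiableM; first exact: differentiable_cst.
apply: differentiable_det => k l; set k' := lift j k; set l' := lift i l.
rewrite (_ : (fun _ => _) = (fun t => A t k' l')) //.
by apply/funext => t; rewrite !mxE.
Qed.

Lemma differentiable_gb_lower i j : tau (A t0) i != 0 ->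
  differentiable (fun t => gb_lower (A t) i j) t0.
Proof.
rewrite /gb_lower; case: leqP => _ ti; last exact: differentiable_cst.
by apply: differentiable_div => //; [exact: differentiable_adj | exact: differentiable_tau].
Qed.

Lemma differentiable_gb_upper i j : tau (A t0) j.+1 != 0 ->
  differentiable (fun t => gb_upper (A t) i j) t0.
Proof.
rewrite /gb_upper; case: leqP => _ ti; last exact: differentiable_cst.
by apply: differentiable_div => //; [exact: differentiable_adj | exact: differentiable_tau].
Qed.

Lemma differentiable_tau_ratio p h :
  tau (A t0) (h - p).+1 * tau (A t0) h != 0 ->
  differentiable (fun t => tau_ratio p (A t) h) t0.
Proof.
move=> den0; have dtau := differentiable_tau.
exact: (differentiable_div (differentiableM (dtau _) (dtau _))
  (differentiableM (dtau _) (dtau _)) den0).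
Qed.

End Differentiability.

(** * Positivity of the initial coefficients *)

Section Positivity.
Variables (R : realType) (p q : nat).

Definition positive_factor (x : letter * smx R) := normalized_positive x.1 x.2.

Lemma Forall_map_mem (I : eqType) (X : Type) (P : X -> Prop) (f : I -> X) (s : seq I) :
  (forall i, i \in s -> P (f i)) -> List.Forall P (map f s).
Proof.
elim: s => [|i s IH] fP; first exact: List.Forall_nil.
apply: List.Forall_cons; first by apply: fP; rewrite mem_head.
by apply: IH => j js; apply: fP; rewrite inE js orbT.
Qed.

Lemma Forall_nth (X : Type) (P : X -> Prop) (s : seq X) x0 k :
  List.Forall P s -> (k < size s)%N -> P (nth x0 s k).
Proof. by move=> Ps; elim: Ps k => [//|x s' Px _ IH] [|k] //=; exact: IH. Qed.

Lemma swaps_positive (F G : seq (letter * smx R)) :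
  swaps F G -> List.Forall positive_factor F -> List.Forall positive_factor G.
Proof.
elim=> [_ _ [s1 s2 U0 L0 L' U' pL pU _]|//|F1 F2 F3 _ IH1 _ IH2 /IH1/IH2 //].
move=> /List.Forall_app[F1 F2]; apply/List.Forall_app; split=> //.
have F3 := List.Forall_inv_tail (List.Forall_inv_tail F2).
by apply: List.Forall_cons; [exact: pL | apply: List.Forall_cons; [exact: pU |]].
Qed.

Lemma factors_positive (Lf Uf : nat -> smx R) a :
  (forall k, (1 <= k <= p)%N -> normalized_positive Lower (Lf k)) ->
  (forall k, (1 <= k <= q)%N -> normalized_positive Upper (Uf k)) ->
  List.Forall positive_factor (rot a (factors p q Lf Uf)).
Proof.
move=> hL hU.
have all_pos : List.Forall positive_factor (factors p q Lf Uf).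
  apply/List.Forall_app; split; apply: Forall_map_mem => k; rewrite mem_iota => kr.
    by apply: hL; lia.
  by apply: hU; lia.
move: all_pos; rewrite -{1}(cat_take_drop a (factors p q Lf Uf)).
by move=> /List.Forall_app[F1 F2]; apply/List.Forall_app.
Qed.

(** Multiplication by [q] permutes the residues, since [q] is prime to [p + q];
    the Chinese remainder theorem provides the preimage. *)
Lemma kidxP rho : coprime p q -> (0 < p + q)%N -> (rho < p + q)%N ->
  (kidx p q rho < p + q)%N /\ (kidx p q rho * q %% (p + q) = rho)%N.
Proof.
move=> cpq M0 rhoM.
have cM : coprime q (p + q) by rewrite /coprime gcdnDr -/(coprime q p) coprime_sym.
have inS : rho \in [seq (k * q %% (p + q))%N | k <- iota 0 (p + q)].
  pose x := chinese q (p + q) 0 rho.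
  have /eqP xq : (x == 0 %[mod q])%N by rewrite /x chinese_modl.
  have xM : (x = rho %[mod p + q])%N by rewrite /x chinese_modr.
  have /dvdnP[y xy] : (q %| x)%N by rewrite /dvdn xq mod0n.
  apply/mapP; exists (y %% (p + q))%N; first by rewrite mem_iota add0n ltn_pmod.
  by rewrite modnMml -xy xM modn_small.
have := inS; rewrite -index_mem size_map size_iota => kM; split=> //.
have := nth_index 0%N inS; rewrite -/(kidx p q rho) (nth_map 0%N) ?size_iota //.
by rewrite nth_iota // add0n.
Qed.

(** The type of the factor read at height [h] is lower exactly when
    [h %% (p + q) < p], in which case [h >= p] forces [h >= p + q]: the entry is
    then a subdiagonal one. *)
Lemma cyc_coef_gt0 (F : seq (letter * smx R)) h : coprime p q -> (1 <= p)%N ->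
  List.Forall positive_factor F -> map fst F = sigma_min p q -> (p <= h)%N ->
  0 < cyc_coef p q F h.
Proof.
move=> cpq hp Fpos Fw ph; rewrite /cyc_coef ltnNge ph /=.
have [kM kE] := kidxP cpq (ltn_addr q hp) (ltn_pmod h (ltn_addr q hp)).
set k := kidx _ _ _ in kM kE *.
have szF : size F = (p + q)%N by rewrite -(size_map fst) Fw size_mkseq.
pose x := nth (Lower, fun _ _ => 0) F k.
have xpos : positive_factor x by apply: Forall_nth => //; rewrite szF.
have x1 : x.1 = if (h %% (p + q) < p)%N then Lower else Upper.
  rewrite /x -(nth_map _ Lower) ?szF // Fw nth_mkseq // kE //.
rewrite -/x; case: x x1 xpos => l B /= ->; case: ltnP => hr [].
  move=> _ + _; have : (0 < h %/ (p + q))%N.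
    rewrite divn_gt0; last by lia.
    by rewrite leqNgt; apply: contraL hr => hM; rewrite modn_small // -leqNgt.
  by case: (h %/ (p + q))%N.
by move=> _ + _.
Qed.

End Positivity.

(** * Reconstruction of the coefficients *)

Lemma formal_lax_theorem (K : numFieldType) (p q r : nat) (ell : 'I_r -> nat)
    (c0 : nat -> K) : (1 <= p)%N -> (1 <= q)%N ->
  (forall h, (h < p)%N -> c0 h = 0) -> (forall h, (p <= h)%N -> c0 h != 0) ->
  let A := formal_moment_matrix p q ell (hess p q c0) in
  (exists! c : nat -> fps r K, lax_solution p q ell c0 c) /\
  forall c : nat -> fps r K, lax_solution p q ell c0 c ->
    [/\ forall h, (h < p)%N -> c h = 0,
        forall N, tau A N \is a GRing.unit
      & forall h, (p <= h)%N -> c h = tau_ratio p A h].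
Proof.
move=> hp hq c0_low c0_neq0 A.
have sol := formal_coef_solution ell hp hq c0_low c0_neq0.
have unq := @lax_solution_unique K p q r ell c0 hp hq.
split; first by exists (formal_coef p q ell c0); split=> // c'; exact: unq.
move=> c /unq/(_ sol) ->; split=> [h|N|h ph]; first exact: formal_coef_low.
  exact: tau_formal_unit.
by rewrite /formal_coef ltnNge ph.
Qed.

Section Analytic.
Variables (R : realType) (L p q : nat).
Local Notation C := R[i].
Local Notation T := 'rV[C]_L.
Variables (H : smx C) (D : set T) (w : nat -> nat -> nat -> T -> C).
Hypothesis (hp : (1 <= p)%N) (hq : (1 <= q)%N).
Hypothesis hw : holomorphic_pairings p q H D w.

Local Notation A := (moment_matrix p q w).

Lemma differentiable_moments t i j : D t -> differentiable (fun t => A t i j) t.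
Proof.
move=> Dt; have [hol _] := hw (i %/ q + j %/ p)%N (ltn_pmod i hq) (ltn_pmod j hp).
exact: hol.
Qed.

Lemma represents_moments i j :
  represents (formal_moment_matrix p q (fun l : 'I_L => l.+1) H i j)
             (fun t => A t i j).
Proof.
apply: near_represents.
by have [_] := hw (i %/ q + j %/ p)%N (ltn_pmod i hq) (ltn_pmod j hp).
Qed.

(** The formal minors represent the minors near the origin, and the denominator
    has nonzero constant term. *)
Lemma tau_ratio_expansion h :
  let F := formal_moment_matrix p q (fun l : 'I_L => l.+1) H in
  open D -> D 0 -> (forall N, tau F N \is a GRing.unit) ->
  exists V : set T,
   [/\ open V, V 0, V `<=` D, holomorphic_on V (fun t => tau_ratio p (A t) h)
     & forall t, V t -> fps_sums_to (tau_ratio p F h) t (tau_ratio p (A t) h)].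
Proof.
move=> F oD D0 uF.
have rtau := represents_tau represents_moments.
have rnum := representsM (rtau (h - p)%N) (rtau h.+1).
have rden := representsM (rtau (h - p).+1) (rtau h).
have [|[n1 den0] rinv] := represents_inv _ rden.
  by rewrite fpsM0 mulf_neq0 // -fps_unitP uF.
have [n2 sums] := represents_sums_to (representsM rnum rinv).
exists (D `&` interior [set t | in_polydisc (maxn n1 n2) t]); split.
- by apply: openI => //; exact: open_interior.
- by split=> //; exact: polydisc_near.
- by move=> t [].
- move=> t [Dt /interior_subset tn]; apply: differentiable_tau_ratio.
    by move=> i j; exact: differentiable_moments.
  by apply: den0; apply: in_polydiscS tn; exact: leq_maxl.
- move=> t [_ /interior_subset tn]; apply: sums; apply: in_polydiscS tn.
  exact: leq_maxr.
Qed.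

(** The minor of order [0] is [1], so that the hypothesis covers all minors up to
    the order [h + 1]. *)
Lemma gauss_borel_at t h : D t -> (forall N, (1 <= N <= h.+1)%N -> tau (A t) N != 0) ->
  [/\ gauss_borel h.+1 (A t) (gb_lower (A t)) (gb_upper (A t)),
      forall i j, (i <= h)%N -> (j <= h)%N ->
        differentiable (fun t => gb_lower (A t) i j) t /\
        differentiable (fun t => gb_upper (A t) i j) t,
      differentiable (fun t => tau_ratio p (A t) h) t
    & (p <= h)%N -> tau_ratio p (A t) h = recurrence_coef p (gb_upper (A t)) h].
Proof.
move=> Dt tauN.
have {}tauN N : (N <= h.+1)%N -> tau (A t) N != 0.
  by case: N => [_|N Nh]; [rewrite /tau det_mx00 oner_eq0 | exact: tauN].
have dA i j := differentiable_moments i j Dt; split.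
- exact: gauss_borel_factors.
- move=> i j ih jh; split.
    by apply: differentiable_gb_lower => //; rewrite tauN // leqW.
  by apply: differentiable_gb_upper => //; rewrite tauN.
- apply: differentiable_tau_ratio => //; rewrite mulf_neq0 ?tauN //.
  by rewrite ltnS leq_subr.
- by move=> ph; rewrite recurrence_coef_gb.
Qed.

End Analytic.

Theorem theorem9p3 (R : realType) (p q : nat) (hp : (1 <= p)%N) (hq : (1 <= q)%N)
    (hpq : coprime p q)
    (Lf Uf : nat -> smx R)
    (hL : forall k, (1 <= k <= p)%N -> normalized_positive Lower (Lf k))
    (hU : forall k, (1 <= k <= q)%N -> normalized_positive Upper (Uf k))
    (a : nat) (ha : (cyc_min p q <= a <= cyc_max p q)%N)
    (F : seq (letter * smx R))
    (hF : swaps (rot a.-1 (factors p q Lf Uf)) F)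
    (hFw : map fst F = sigma_min p q) :
  let c0 : nat -> R[i] := fun h => (cyc_coef p q F h)%:C in
  let H : smx R[i] := hess p q c0 in
  (forall (r : nat) (ell : 'I_r -> nat),
     injective ell -> (forall l, (1 <= ell l)%N) ->
     let A := formal_moment_matrix p q ell H in
     (exists! c : nat -> fps r R[i], lax_solution p q ell c0 c) /\
     forall c : nat -> fps r R[i], lax_solution p q ell c0 c ->
       [/\ forall h, (h < p)%N -> c h = 0,
           forall N, tau A N \is a GRing.unit
         & forall h, (p <= h)%N -> c h = tau_ratio p A h]) /\
  (forall (L : nat) (c : nat -> fps L R[i]),
     lax_solution p q (fun l : 'I_L => l.+1) c0 c ->
   forall (D : set 'rV[R[i]]_L) (w : nat -> nat -> nat -> 'rV[R[i]]_L -> R[i]),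
     open D -> connected D -> D 0 -> holomorphic_pairings p q H D w ->
   let A := moment_matrix p q w in
   exists ca : nat -> 'rV[R[i]]_L -> R[i],
   [/\ forall h, (p <= h)%N ->
         let Dh := tau_domain A D h in
         [/\ holomorphic_on Dh (ca h),
             forall t, Dh t -> ca h t = tau_ratio p (A t) h
           & exists S U : nat -> nat -> 'rV[R[i]]_L -> R[i],
             (forall i j, (i <= h)%N -> (j <= h)%N ->
                holomorphic_on Dh (S i j) /\ holomorphic_on Dh (U i j)) /\
             (forall t, Dh t ->
                gauss_borel h.+1 (A t) (fun i j => S i j t) (fun i j => U i j t) /\
                ca h t = recurrence_coef p (fun i j => U i j t) h)],
       forall h, (p <= h)%N ->
         exists V : set 'rV[R[i]]_L,
         [/\ open V, V 0, V `<=` D, holomorphic_on V (ca h)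
           & forall t, V t -> fps_sums_to (c h) t (ca h t)]
     & (forall N t, (1 <= N)%N -> D t -> tau (A t) N != 0) ->
         (forall h, (p <= h)%N ->
            holomorphic_on D (ca h) /\
            forall t, D t -> ca h t = tau_ratio p (A t) h) /\
         exists S U : nat -> nat -> 'rV[R[i]]_L -> R[i],
           (forall i j, holomorphic_on D (S i j) /\ holomorphic_on D (U i j)) /\
           (forall t, D t ->
              (forall N, gauss_borel N (A t) (fun i j => S i j t)
                                             (fun i j => U i j t)) /\
              forall h, (p <= h)%N ->
                ca h t = recurrence_coef p (fun i j => U i j t) h)]).
Proof.
move=> c0 H.
have Fpos := swaps_positive hF (factors_positive a.-1 hL hU).
have c0_low h : (h < p)%N -> c0 h = 0 by rewrite /c0 /cyc_coef => ->.
have c0_neq0 h : (p <= h)%N -> c0 h != 0.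
  move=> ph; have := cyc_coef_gt0 hpq hp Fpos hFw ph.
  by rewrite /c0 -ltcR => /lt0r_neq0.
split=> [r ell _ _ A|L c csol D w oD cD D0 hw A].
  exact: formal_lax_theorem.
have [_ /(_ c csol)[_ uF cE]] :=
  formal_lax_theorem (fun l : 'I_L => l.+1) hp hq c0_low c0_neq0.
exists (fun h t => tau_ratio p (A t) h); split.
- move=> h ph Dh.
  have DhE t : Dh t -> D t /\ forall N, (1 <= N <= h.+1)%N -> tau (A t) N != 0.
    exact: connected_component_sub.
  have gb t (Dht : Dh t) := gauss_borel_at hp hq hw (DhE t Dht).1 (DhE t Dht).2.
  split=> [t /gb[]|//|] //.
  exists (fun i j t => gb_lower (A t) i j), (fun i j t => gb_upper (A t) i j); split.
    move=> i j ih jh; split=> t /gb[_ dLU _ _]; by have [] := dLU i j ih jh.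
  by move=> t /gb[gbt _ _ cr]; split=> //; exact: cr.
- move=> h ph; rewrite cE //; exact: tau_ratio_expansion.
- move=> tauD.
  have gb h t (Dt : D t) := gauss_borel_at hp hq hw Dt
    (fun N (hN : (1 <= N <= h.+1)%N) => tauD N t (andP hN).1 Dt).
  split=> [h ph|]; first by split=> [t /(gb h)[]|].
  exists (fun i j t => gb_lower (A t) i j), (fun i j t => gb_upper (A t) i j); split.
    move=> i j; split=> t /(gb (maxn i j))[_ dLU _ _];
      by have [] := dLU i j (leq_maxl _ _) (leq_maxr _ _).
  move=> t Dt; split=> [N|h ph]; last by have [_ _ _] := gb h t Dt; exact.
  apply: gauss_borel_factors => -[_|n nN]; last exact: tauD.
  by rewrite /tau det_mx00 oner_eq0.
Qed.
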